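(* Let $\eta$ be the morphism on $\{0,1,2,3\}^*$ defined by $\eta(0)=010203$, $\eta(1)=2013$, $\eta(2)=0132$, $\eta(3)=0102013203$, let $\eta^\omega(0)$ be its infinite fixed point starting with $0$, and let $\gamma:\{0,1,2,3\}^*\to\{0,1,2\}^*$ be the morphism defined by $\gamma(0)=012021201210120102$, $\gamma(1)=012101202120102$, $\gamma(2)=012021201020121$, $\gamma(3)=012021201210120212010201210120102$. Then: (a) $\gamma(\eta^\omega(0))$ contains exactly $16$ distinct palindromes (including the empty word) and is $\tfrac{41}{22}^+$-free. (b) Every bi-infinite word over $\{0,1,2\}$ that is $\tfrac{52}{27}$-free and contains at most $16$ distinct palindromes (including the empty word) has the same set of finite factors as either $\gamma(\eta^\omega(0))$ or its reversal $\gamma(\eta^\omega(0))^R$. (c) Every recurrent infinite word over $\{0,1,2\}$ that is $\tfrac{25}{13}$-free and contains at most $17$ distinct palindromes (including the empty word) has the same set of finite factors as either $\gamma(\eta^\omega(0))$ or its reversal $\gamma(\eta^\omega(0))^R$.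
   Context: For a nonempty finite word $u$ and a rational $r>1$, a word $v$ is an $r$-power (of $u$) if $v$ is a prefix of the infinite periodic word $uuu\cdots$ and $|v|/|u|=r$. A (finite, infinite or bi-infinite) word is $\beta$-free (resp. $\beta^+$-free) if none of its factors is an $r$-power with $r\ge\beta$ (resp. $r>\beta$). A palindrome is a finite word equal to its reversal; a word contains a palindrome if the palindrome is one of its factors. An infinite word is recurrent if each of its factors occurs infinitely often in it. For an infinite word $\mathbf u$, the set of factors of $\mathbf u^R$ is the set of reversals of the factors of $\mathbf u$. Morphisms extend to infinite words by letterwise application and concatenation; $\eta^\omega(0)=\lim_{n\to\infty}\eta^n(0)$. *)

(* Defs.v *)
From mathcomp Require Export all_boot all_order all_algebra.
From mathcomp Require Export boolp classical_sets functions cardinality.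

Set Implicit Arguments.
Unset Strict Implicit.
Unset Printing Implicit Defensive.

Import Order.TTheory GRing.Theory Num.Theory.

Local Open Scope classical_set_scope.

(* Finite words over A are [seq A], infinite words are functions [nat -> A] and
   bi-infinite words are functions [int -> A]. *)

Section Words.
Variable A : eqType.
Implicit Types (u v w : seq A) (x : nat -> A) (y : int -> A) (L : set (seq A)).

Definition occurs_at x w (i : nat) : Prop :=
  w = mkseq (fun j => x (i + j)%N) (size w).

Definition factors x : set (seq A) := [set w | exists i, occurs_at x w i].

Definition bifactors y : set (seq A) :=
  [set w | exists i : int, w = mkseq (fun j => y (i + j%:Z)%R) (size w)].

Definition recurrent x : Prop :=
  forall w, factors x w -> infinite_set [set i | occurs_at x w i].

(* The periodic word uuu... for the nonempty word u = a :: s. *)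
Definition periodic (a : A) (s : seq A) : nat -> A :=
  fun i => nth a (a :: s) (i %% size (a :: s)).

Definition is_power (r : rat) v : Prop :=
  (1 < r)%R /\
  exists a s, v = mkseq (periodic a s) (size v) /\
    ((size v)%:R / (size (a :: s))%:R = r)%R.

(* Power-freeness and palindromes only depend on the set of factors of a word,
   so they are defined on that set, uniformly for all kinds of words. *)

Definition power_free (beta : rat) L : Prop :=
  forall v r, L v -> (beta <= r)%R -> ~ is_power r v.

Definition power_free_plus (beta : rat) L : Prop :=
  forall v r, L v -> (beta < r)%R -> ~ is_power r v.

Definition palindromes L : set (seq A) := [set w | L w /\ w = rev w].

End Words.

Section Morphisms.
Variables A B : eqType.

Definition morph (h : A -> seq B) (w : seq A) : seq B := flatten (map h w).

(* The image of an infinite word under a nonerasing morphism: since every letter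
   has a nonempty image, the first n+1 letters of x determine the letter of
   index n of the image, and the default b is never used (see [morph_infE]). *)
Definition morph_inf (b : B) (h : A -> seq B) (x : nat -> A) : nat -> B :=
  fun n => nth b (morph h (mkseq x n.+1)) n.

Lemma size_morph (h : A -> seq B) (w : seq A) :
  (forall a, h a != [::]) -> size w <= size (morph h w).
Proof.
move=> h0; elim: w => //= a w IH; rewrite /morph /= size_cat -add1n leq_add //.
by rewrite lt0n size_eq0 h0.
Qed.

Lemma morph_cat (h : A -> seq B) (w1 w2 : seq A) :
  morph h (w1 ++ w2) = morph h w1 ++ morph h w2.
Proof. by rewrite /morph map_cat flatten_cat. Qed.

Lemma prefix_mkseq (T : eqType) (x : nat -> T) m n :
  m <= n -> prefix (mkseq x m) (mkseq x n).
Proof.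
by move=> mn; apply/prefixP; exists (map x (iota m (n - m)));
   rewrite /mkseq -map_cat -{2}[m]add0n -iotaD subnKC.
Qed.

Lemma nth_prefix (T : eqType) (b : T) (s t : seq T) i :
  prefix s t -> i < size s -> nth b t i = nth b s i.
Proof. by move=> /prefixP[r ->] lt_i; rewrite nth_cat lt_i. Qed.

Lemma prefix_morph (h : A -> seq B) (s t : seq A) :
  prefix s t -> prefix (morph h s) (morph h t).
Proof. by move=> /prefixP[r ->]; rewrite morph_cat prefix_prefix. Qed.

Lemma morph_infE (b : B) (h : A -> seq B) (x : nat -> A) n :
  (forall a, h a != [::]) ->
  mkseq (morph_inf b h x) (size (morph h (mkseq x n))) = morph h (mkseq x n).
Proof.
move=> h0; apply: (@eq_from_nth _ b); rewrite size_mkseq // => i lt_i.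
rewrite nth_mkseq // /morph_inf.
have sz : i < size (morph h (mkseq x i.+1)).
  by apply: leq_trans (size_morph _ h0); rewrite size_mkseq.
have [le_n|/ltnW le_i] := leqP n i.+1.
  by apply: nth_prefix => //; apply/prefix_morph/prefix_mkseq.
by apply/esym/nth_prefix => //; apply/prefix_morph/prefix_mkseq.
Qed.

End Morphisms.

(* The limit of the words h^n(a), for a nonerasing h such that h(a) = a s with s
   nonempty: the word h^n(a) is then a prefix of h^(n+1)(a) and has length > n,
   so it contains the letter of index n of the limit (see [morph_omegaE]). *)
Definition morph_omega (A : eqType) (h : A -> seq A) (a : A) : nat -> A :=
  fun n => nth a (iter n (morph h) [:: a]) n.

Section Omega.
Variables (A : eqType) (h : A -> seq A) (a : A) (s : seq A).
Hypotheses (h0 : forall b, h b != [::]) (s0 : s != [::]) (ha : h a = a :: s).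

Let W n := iter n (morph h) [:: a].

Lemma iter_morph_prefix m n : m <= n -> prefix (W m) (W n).
Proof.
have step k : prefix (W k) (W k.+1).
  elim: k => [|k IH]; last exact: prefix_morph IH.
  by rewrite /W /= /morph /= cats0 ha -cat1s prefix_prefix.
elim: n => [|n IH]; first by rewrite leqn0 => /eqP->; rewrite prefix_refl.
rewrite leq_eqVlt ltnS => /orP[/eqP->|/IH/prefix_trans]; first exact: prefix_refl.
by apply.
Qed.

Lemma size_iter_morph n : n < size (W n).
Proof.
elim: n => // n IH; have /prefixP[r Wr] := iter_morph_prefix (leq0n n).
have -> : W n.+1 = a :: s ++ morph h r.
  by rewrite -[W n.+1]/(morph h (W n)) Wr /= /morph /= ha.
apply: (leq_ltn_trans IH); rewrite Wr /= ltnS size_cat -add1n leq_add //.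
  by rewrite lt0n size_eq0.
exact: size_morph.
Qed.

Lemma morph_omegaE n : mkseq (morph_omega h a) (size (W n)) = W n.
Proof.
apply: (@eq_from_nth _ a); rewrite size_mkseq // => i lt_i.
rewrite nth_mkseq // /morph_omega -/(W i).
have [le_n|/ltnW le_i] := leqP n i.
  exact/nth_prefix/lt_i/iter_morph_prefix.
exact/esym/nth_prefix/size_iter_morph/iter_morph_prefix.
Qed.

Lemma morph_omega_fix : morph_inf a h (morph_omega h a) =1 morph_omega h a.
Proof.
move=> n; have := morph_infE a (morph_omega h a) (size (W n)) h0.
rewrite morph_omegaE -[morph h (W n)]/(W n.+1) -(morph_omegaE n.+1) size_mkseq.
have lt_n : n < size (W n.+1) by apply: ltnW; apply: size_iter_morph.
by move=> /(congr1 (nth a ^~ n)); rewrite !nth_mkseq.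
Qed.

End Omega.

(* Digits are sent to letters by [inZp], the reduction of a natural number
   modulo the size of the alphabet, which is the identity on those used here. *)
Definition word3 (s : seq nat) : seq 'I_3 := map inZp s.
Definition word4 (s : seq nat) : seq 'I_4 := map inZp s.

Definition eta (c : 'I_4) : seq 'I_4 :=
  word4 (nth [::]
    [:: [:: 0;1;0;2;0;3];
        [:: 2;0;1;3];
        [:: 0;1;3;2];
        [:: 0;1;0;2;0;1;3;2;0;3]] c).

Definition gamma (c : 'I_4) : seq 'I_3 :=
  word3 (nth [::]
    [:: [:: 0;1;2;0;2;1;2;0;1;2;1;0;1;2;0;1;0;2];
        [:: 0;1;2;1;0;1;2;0;2;1;2;0;1;0;2];
        [:: 0;1;2;0;2;1;2;0;1;0;2;0;1;2;1];
        [:: 0;1;2;0;2;1;2;0;1;2;1;0;1;2;0;2;1;2;0;1;0;2;0;1;2;1;0;1;2;0;1;0;2]]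
    c).

Definition eta_omega : nat -> 'I_4 := morph_omega eta ord0.

Definition gamma_eta_omega : nat -> 'I_3 := morph_inf ord0 gamma eta_omega.

Lemma eta_omega_fix : morph_inf ord0 eta eta_omega =1 eta_omega.
Proof.
apply: (@morph_omega_fix _ _ _ (word4 [:: 1;0;2;0;3])) => //.
  by case=> [[|[|[|[|//]]]]].
by rewrite /eta /word4 /=; congr (_ :: _); apply: val_inj.
Qed.

(* Main.v *)
(* A ternary square-free word is given by its first letter and the word of its differences
   +1, -1 modulo 3.  The differences of gamma(eta^omega(0)) are the image of the fixed point t of
   sig : a -> bbaaa, b -> bbaaabb under tau : a -> +++--, b -> +++--+.  The sum modulo 3 of the
   differences coded by a word is preserved by sig, so all factors of t occur with all three
   starting letters, and repetitions of the ternary word are those repetitions of t whose period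
   has sum 0 modulo 3.  Both morphisms are recognizable, so such repetitions descend to shorter
   ones, and an inequality between the weights of the period and of the excess that is inherited
   by images reduces (a) to finitely many short repetitions.

   For (b) and (c), short searches show that, up to a permutation of the letters, all 16
   palindromes of gamma(eta^omega(0)) are unavoidable, and that in (c) a 17th one could not
   occur twice.  Having only these palindromes forces the differences, or their opposites, to be an
   image under tau.  The preimage has no repetition that stays above 52/27 under all tau o sig^n;
   a language with this property consists of factors of images under sig, and its preimage under
   sig has the same property.  Hence it is the language of t. *)

Require Import Defs.
From mathcomp Require Import fingroup perm finmap zify lra.

Set Implicit Arguments.
Unset Strict Implicit.
Unset Printing Implicit Defensive.

Import Order.TTheory GRing.Theory Num.Theory.

(** * Searching factorial languages *)

Section Languages.
Variable A : eqType.
Implicit Types (u v w x y z : seq A) (L : seq A -> Prop).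

Definition factorial L := forall u w, infix u w -> L w -> L u.
Definition lext L := forall w, L w -> exists a, L (a :: w).
Definition rext L := forall w, L w -> exists a, L (rcons w a).

Definition extendable L := [/\ factorial L, lext L & rext L].

Lemma extend_left L n w :
  lext L -> L w -> exists2 x, size x = n & L (x ++ w).
Proof.
move=> Ll Lw; elim: n => [|n [x sx Lx]]; first by exists [::].
by have [a La] := Ll _ Lx; exists (a :: x); rewrite //= sx.
Qed.

Lemma extend_right L n w :
  rext L -> L w -> exists2 y, size y = n & L (w ++ y).
Proof.
move=> Lr Lw; elim: n => [|n [y sy Ly]]; first by exists [::]; rewrite ?cats0.
by have [a La] := Lr _ Ly; exists (rcons y a); rewrite ?size_rcons ?sy // -rcons_cat.
Qed.

Lemma extend_both L m n w : extendable L -> L w ->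
  exists x y, [/\ size x = m, size y = n & L (x ++ w ++ y)].
Proof.
move=> [_ Ll Lr] Lw; have [y sy Ly] := extend_right n Lr Lw.
by have [x sx Lx] := extend_left m Ll Ly; exists x, y.
Qed.

Lemma factorial_prefix L (Lf : factorial L) x y : L (x ++ y) -> L x.
Proof. by apply: Lf; rewrite prefixW // prefix_prefix. Qed.

Lemma factorial_suffix L (Lf : factorial L) x y : L (x ++ y) -> L y.
Proof. by apply: Lf; rewrite suffixW // suffix_suffix. Qed.

Arguments factorial_prefix {L} Lf {x y}.
Arguments factorial_suffix {L} Lf {x y}.

(* In particular every p >= size w is a period. *)
Definition period (p : nat) w := prefix (drop p w) w.

Lemma prefix_le u v w :
  prefix u w -> prefix v w -> size u <= size v -> prefix u v.
Proof.
rewrite !prefixE => /eqP eu /eqP ev le; apply/eqP.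
by rewrite -ev take_takel.
Qed.

Lemma prefix_cat2l x u v : prefix (x ++ u) (x ++ v) = prefix u v.
Proof. by rewrite prefix_catr // eqxx. Qed.

Lemma suffix_cat2r x u v : suffix (u ++ x) (v ++ x) = suffix u v.
Proof. by rewrite suffix_catl // eqxx. Qed.

Lemma prefix_drop n u v : prefix u v -> prefix (drop n u) (drop n v).
Proof.
move=> /prefixP[x ->]; rewrite drop_cat; case: ltnP => h; first exact: prefix_prefix.
by rewrite drop_oversize // prefix0s.
Qed.

Lemma suffix_le u v w :
  suffix u w -> suffix v w -> size u <= size v -> suffix u v.
Proof. by rewrite -!prefix_rev => h1 h2 h; apply: prefix_le h1 h2 _; rewrite !size_rev. Qed.

Definition avoids (F : seq (seq A)) w := all (fun f => ~~ infix f w) F.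

Definition avoids_prefix (F : seq (seq A)) w := all (fun f => ~~ prefix f w) F.

Lemma avoids_infix F u w : infix u w -> avoids F w -> avoids F u.
Proof.
move=> uw /allP Fw; apply/allP => f /Fw; apply: contra => fu.
exact: infix_trans fu uw.
Qed.

Section Search.
Variables (S : Type) (step : S -> seq A -> option S) (leaf : seq A -> bool).
Variable letters : seq A.

(* Words grow to the left; step returns None on words that are certainly not in L. *)
Fixpoint search (n : nat) (st : S) w : bool :=
  if n is n'.+1 then
    all (fun a => if step st (a :: w) is Some st' then search n' st' (a :: w)
                  else true) letters
  else leaf w.

Variables (L : seq A -> Prop) (inv : S -> Prop).
Hypothesis lettersP : forall a, a \in letters.
Hypothesis Lf : factorial L.
Hypothesis stepP : forall st w, inv st -> L w ->
  exists2 st', step st w = Some st' & inv st'.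

(** [L] is factorial, so all suffixes of [x ++ w] are in [L] and [step] never prunes the branch that
    spells [x] from right to left. *)
Lemma searchP n st w x : search n st w -> inv st -> size x = n ->
  L (x ++ w) -> leaf (x ++ w).
Proof.
elim: n st w x => [|n IH] st w x /=; first by move=> ? _ /size0nil->.
move=> /allP h ist; case/lastP: x => // x a; rewrite size_rcons => -[sx].
rewrite -cats1 -catA => Lx.
have [st' e ist'] := stepP ist (factorial_suffix Lf Lx).
by have := h a (lettersP a); rewrite /= in e *; rewrite e => /IH; apply.
Qed.

End Search.

Section SearchAvoiding.
Variables (letters : seq A) (F : seq (seq A)).
Hypothesis lettersP : forall a, a \in letters.

(** Words grow to the left, so a new occurrence of a forbidden word can only be a prefix. *)
Definition avoid_step (_ : unit) w := if has (fun f => prefix f w) F then None else Some tt.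

Lemma avoid_stepP st w : avoids F w -> avoid_step st w = Some tt.
Proof.
move=> /allP Fw; rewrite /avoid_step; case: hasP => // -[f /Fw fw fp].
by rewrite prefixW in fw.
Qed.

Lemma search_avoidsP leaf n w : search avoid_step leaf letters n tt [::] ->
  size w = n -> avoids F w -> leaf w.
Proof.
move=> s sw Fw; rewrite -[w]cats0.
apply: (searchP (L := avoids F) (inv := fun=> True) lettersP _ _ s) => //.
- by move=> u v; apply: avoids_infix.
- by move=> st u _ /(avoid_stepP st)->; exists tt.
- by rewrite cats0.
Qed.

(** A word [g] of [G] may itself avoid [F]. It is excluded because [L] extends it by [k] letters on
    the left, and then on the right up to length [n], whereas no word of length [n] avoiding [F] has
    [g] at offset [k]. *)
Lemma search_avoids L G k n : extendable L -> (forall w, L w -> avoids F w) ->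
  search avoid_step (fun w => avoids_prefix G (drop k w)) letters n tt [::] ->
  all (fun g => k + size g <= n) G -> forall w, L w -> avoids G w.
Proof.
move=> Lext LF s /allP Gn w Lw; apply/allP => g gG; apply/negP => gw.
have [Lf _ _] := Lext; have Lg := Lf _ _ gw Lw.
have [x [y [sx sy Lxy]]] := extend_both k (n - (k + size g)) Lext Lg.
have := search_avoidsP s _ (LF _ Lxy).
rewrite !size_cat sx sy addnA subnKC ?Gn // => /(_ erefl)/allP/(_ _ gG).
by rewrite drop_size_cat // prefix_prefix.
Qed.

End SearchAvoiding.
End Languages.

(** * Desubstitution *)

Lemma infix_morph (A B : eqType) (h : A -> seq B) s t :
  infix s t -> infix (morph h s) (morph h t).
Proof. by move=> /infixP[x [y ->]]; rewrite !morph_cat infix_infix. Qed.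

Section Morph.
Variables (A B : eqType) (h : A -> seq B).
Implicit Types (c : A) (s : seq A).

Lemma morph1 c : morph h [:: c] = h c. Proof. exact: cats0. Qed.
Lemma morph_cons c s : morph h (c :: s) = h c ++ morph h s. Proof. by []. Qed.
Lemma morph_rcons s c : morph h (rcons s c) = morph h s ++ h c.
Proof. by rewrite -cats1 morph_cat morph1. Qed.

End Morph.

(** Outer letters of [s] are dropped as long as [w] misses their images. When this stops, [w] covers
    the images of all inner letters and meets both outer ones, whence the 2. *)
Lemma infix_morph_trim (A B : eqType) (h : A -> seq B) s w :
  w != [::] -> infix w (morph h s) ->
  exists2 s', infix s' s & infix w (morph h s') /\
   (size s' <= 1 \/ exists a m b,
      s' = a :: rcons m b /\ size (morph h m) + 2 <= size w).
Proof.
move=> w0; have w_gt0 : 0 < size w by rewrite lt0n size_eq0.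
have [n] := ubnP (size s); elim: n s => // n IH s; rewrite ltnS => sn.
case: (leqP (size s) 1) => [s1 ws|]; first by exists s; rewrite ?infix_refl //; auto.
case: s sn => // a s sn; case/lastP: s sn => // m b sn _ /infixP[x [y e]].
have e' : h a ++ morph h (rcons m b) = x ++ w ++ y by rewrite -e.
have [lea|lta] := leqP (size (h a)) (size x).
  have wi : infix w (morph h (rcons m b)).
    have := congr1 (drop (size (h a))) e'.
    rewrite drop_size_cat // drop_cat; case: ltnP => [_ ->|h1]; first exact: infix_infix.
    have -> : size (h a) - size x = 0 by apply/eqP; rewrite subn_eq0.
    by rewrite drop0 => ->; rewrite prefix_infix.
  have [|s' s's ws'] := IH (rcons m b) _ wi; first by apply: leq_trans sn; rewrite /= ltnS.
  by exists s' => //; apply: infix_trans s's _; rewrite infix_cons.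
have e2 : (morph h (a :: m) ++ h b) = (x ++ w) ++ y.
  by rewrite -catA -e -rcons_cons morph_rcons.
have [leb|ltb] := leqP (size (h b)) (size y).
  have wi : infix w (morph h (a :: m)).
    have /prefixP[z ->] : prefix (x ++ w) (morph h (a :: m)).
      apply: (@prefix_le _ _ _ ((x ++ w) ++ y)); rewrite ?prefix_prefix //.
        by rewrite -e2 prefix_prefix.
      by have := congr1 size e2; rewrite !size_cat; lia.
    by rewrite -catA infix_infix.
  have [|s' s's ws'] := IH (a :: m) _ wi.
    by apply: leq_trans sn; rewrite /= size_rcons.
  by exists s' => //; apply: infix_trans s's _; rewrite -rcons_cons infix_rcons.
exists (a :: rcons m b); first exact: infix_refl.
split; first by apply/infixP; exists x, y.
right; exists a, m, b; split => //; have := congr1 size e2.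
by rewrite /morph /= -/(morph h m) !size_cat; lia.
Qed.

(* Every word H t ++ tl starts with tl, so a repetition of excess v in t yields one of
   excess H v ++ tl in the image. *)
Section Code.
Variables (A B : eqType) (h : A -> seq B) (tl : seq B).
Hypothesis h0 : forall c, h c != [::].
Local Notation H := (morph h).

Section Descent.
Hypothesis tailP : forall c, prefix tl (h c ++ tl).

Lemma tail_morph t : prefix tl (H t ++ tl).
Proof.
elim: t => [|c t IH]; first exact: prefix_refl.
rewrite morph_cons -catA; apply: prefix_trans (tailP c) _.
by rewrite prefix_cat2l.
Qed.

Lemma period_morph p t : period p t -> period (size (H (take p t))) (H t ++ tl).
Proof.
move=> pt; rewrite /period.
have -> : drop (size (H (take p t))) (H t ++ tl) = H (drop p t) ++ tl.
  by rewrite -{2}(cat_take_drop p t) morph_cat -catA drop_size_cat.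
move/prefixP: pt => [r {2}->]; rewrite morph_cat -catA.
by rewrite prefix_cat2l tail_morph.
Qed.

Variables (L : seq B -> Prop) (F : seq (seq B)) (nL nR nC : nat).
Hypothesis Lext : extendable L.
Hypothesis LF : forall w, L w -> avoids F w.
Hypothesis rightP : forall r, size r = nR -> avoids F (tl ++ r) ->
  exists c, prefix (h c ++ tl) (tl ++ r).
Hypothesis leftP : forall x, size x = nL -> avoids F (x ++ tl) ->
  exists c, suffix (h c) x.
Hypothesis centerP : forall w, size w = nC -> avoids F w -> infix tl w.

(** The trailing [tl] is forced by whatever blocks follow, and [rightP] needs it to read the next
    block. *)
Definition desubstitute t := L (H t ++ tl).

Lemma desubstitute_ext : extendable desubstitute.
Proof.
have [Lf Ll Lr] := Lext; split.
- move=> u w /infixP[x [y ->]]; rewrite /desubstitute !morph_cat -!catA.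
  move=> /(factorial_suffix Lf); have /prefixP[z ->] := tail_morph y.
  by rewrite catA => /(factorial_prefix Lf).
- move=> w Lw; have [x sx Lx] := extend_left nL Ll Lw.
  have [y yP] := prefixP (tail_morph w).
  have [|c /suffixP[z ez]] := leftP sx.
    apply: LF; apply: (factorial_prefix Lf (y := y)).
    by rewrite -catA -yP.
  exists c; apply: (factorial_suffix Lf (x := z)).
  by rewrite morph_cons -catA catA -ez.
- move=> w Lw; have [y sy Ly] := extend_right nR Lr Lw.
  have [|c /prefixP[z ez]] := rightP sy.
    by apply: LF; apply: (factorial_suffix Lf (x := (H w))); rewrite catA.
  exists c; apply: (factorial_prefix Lf (y := z)).
  suff -> : (H (rcons w c) ++ tl) ++ z = (H w ++ tl) ++ y by [].
  by rewrite morph_rcons -!catA ez -!catA.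
Qed.

Lemma parse x s r : L (x ++ H s ++ tl ++ r) ->
  exists s' r', H s ++ tl ++ r = H s' ++ tl ++ r' /\ size r' < nR.
Proof.
have [Lf _ _] := Lext.
have [n] := ubnP (size r); elim: n s r => // n IH s r; rewrite ltnS => rn Lx.
have [small|big] := ltnP (size r) nR; first by exists s, r.
have [||c /prefixP[z ez]] := rightP (r := take nR r).
- by rewrite size_takel.
- apply: LF; apply: Lf Lx; rewrite -{2}(cat_take_drop nR r).
  by rewrite !catA -(catA _ tl) -[X in infix _ X]catA infix_infix.
have e : H s ++ tl ++ r = H (rcons s c) ++ tl ++ z ++ drop nR r.
  by rewrite morph_rcons -!catA -{1}(cat_take_drop nR r) !(catA tl) ez -!catA.
have hc : 0 < size (h c) by rewrite lt0n size_eq0.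
have [||s' [r' [e' lt']]] := IH (rcons s c) (z ++ drop nR r).
- have := congr1 size e; rewrite morph_rcons !size_cat; lia.
- by rewrite -e.
by exists s', r'; rewrite e.
Qed.

Lemma desubstitute_cover w : L w -> exists2 t, desubstitute t & infix w (H t).
Proof.
have [Lf _ _] := Lext.
(* The [nC] letters on the left contain a [tl], where parsing can start. On the right, parsing
   leaves [tl] and fewer than [nR] letters unread, so that all of [w] is read. *)
move=> /(extend_both nC (nR + size tl) Lext)[x [y [sx sy Lxy]]].
have /infixP[x0 [x1 ex]] : infix tl x.
  by apply: (centerP sx); apply: LF; exact: (factorial_prefix Lf Lxy).
have Lp : L (x0 ++ H [::] ++ tl ++ (x1 ++ w ++ y)) by move: Lxy; rewrite ex -!catA.
have [s [r [e lt_r]]] := parse Lp.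
rewrite /= in e; exists s.
  apply: (factorial_prefix Lf (y := r)); apply: (factorial_suffix Lf (x := x0)).
  by rewrite -catA -e.
have : prefix (tl ++ x1 ++ w) (H s).
  apply: (@prefix_le _ _ _ (H s ++ tl ++ r)); first last.
  - have := congr1 size e; rewrite !size_cat; lia.
  - exact: prefix_prefix.
  by rewrite -e !catA prefix_prefix.
by move=> /prefixP[z ->]; rewrite catA -catA infix_infix.
Qed.

End Descent.

Section Overlap.
(* In a word H s, a suffix satisfying cut starts at the boundary of a block. *)
Variable cut : seq B -> bool.
Hypothesis cut0 : ~~ cut [::].
Hypothesis cut_prefix : forall z z', prefix z z' -> cut z -> cut z'.
Hypothesis noCut : forall c s j, 0 < j < size (h c) -> ~~ cut (drop j (h c ++ H s)).
Hypothesis branch : forall z c1 c2 s1 s2, c1 != c2 ->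
  prefix z (h c1 ++ H s1) -> prefix z (h c2 ++ H s2) -> prefix z tl.
Hypothesis last_inj : forall x1 x2 c1 c2, last x1 (h c1) = last x2 (h c2) -> c1 = c2.

Lemma synchronize s x z : H s = x ++ z -> cut z ->
  exists s1 s2, [/\ s = s1 ++ s2, x = H s1 & z = H s2].
Proof.
elim: s x => [|c s IH] x e cz.
  by case: x e cz => //= <-; rewrite (negPf cut0).
have [xe|x0] := eqVneq x [::]; first by exists [::], (c :: s); rewrite e xe.
move: e; rewrite morph_cons => e.
have [lt|le] := ltnP (size x) (size (h c)).
  have := @noCut c s (size x); rewrite lt0n size_eq0 x0 lt e drop_size_cat // cz.
  by move=> /(_ isT).
have ex : x = h c ++ drop (size (h c)) x.
  rewrite -{1}(cat_take_drop (size (h c)) x); congr (_ ++ _).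
  have := congr1 (take (size (h c))) e.
  by rewrite take_size_cat // takel_cat.
move: e; rewrite ex -catA => /eqP; rewrite eqseq_cat // eqxx => /eqP e.
have [s1 [s2 [-> e1 e2]]] := IH _ e cz.
by exists (c :: s1), s2; rewrite morph_cons -e1.
Qed.

(** Equal first letters are stripped; at the first mismatch [branch] lets [z] run on at most along
    [tl]. *)
Lemma common_prefix z q1 q2 : prefix z (H q1) -> prefix z (H q2) ->
  exists v, [/\ prefix v q1, prefix v q2 & prefix z (H v ++ tl)].
Proof.
elim: q1 q2 z => [|c1 q1 IH] [|c2 q2] z; rewrite ?prefixs0.
- by move=> /eqP->; exists [::]; rewrite !prefix0s.
- by move=> /eqP->; exists [::]; rewrite !prefix0s.
- by move=> _ /eqP->; exists [::]; rewrite !prefix0s.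
rewrite !morph_cons; have [<-|ne] := eqVneq c1 c2; last first.
  move=> p1 p2; exists [::]; rewrite !prefix0s; split => //.
  exact: branch ne p1 p2.
move=> p1 p2; have [small|big] := leqP (size z) (size (h c1)).
  exists [:: c1]; rewrite /= !prefix0s eqxx morph1; split => //.
  apply: prefix_catl; apply: prefix_le p1 _ small; exact: prefix_prefix.
have /prefixP[z' ez] : prefix (h c1) z.
  by apply: prefix_le p1 (ltnW big); rewrite prefix_prefix.
move: p1 p2; rewrite ez !prefix_cat2l => p1 p2.
have [v [v1 v2 vz]] := IH _ _ p1 p2.
exists (c1 :: v); rewrite /= eqxx v1 v2; split => //.
by rewrite morph_cons -catA prefix_cat2l.
Qed.

Lemma common_suffix z q1 q2 : suffix z (H q1) -> suffix z (H q2) ->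
  exists v, [/\ suffix v q1, suffix v q2 & suffix z (H v)].
Proof.
elim/last_ind: q1 q2 z => [|q1 c1 IH] q2 z; first rewrite suffixs0.
  by move=> /eqP-> _; exists [::]; rewrite !suffix0s.
case/lastP: q2 => [|q2 c2]; first rewrite suffixs0.
  by move=> _ /eqP->; exists [::]; rewrite !suffix0s.
case/lastP: z => [|z a]; first by move=> _ _; exists [::]; rewrite !suffix0s.
rewrite !morph_rcons => s1 s2.
have lastE c q : suffix (rcons z a) (q ++ h c) -> last a (h c) = a.
  move=> /suffixP[y /(congr1 (last a))].
  by rewrite -rcons_cat last_rcons last_cat; case: (h c) (h0 c).
have ec : c1 = c2.
  by apply: (@last_inj a a); rewrite (lastE _ _ s1) (lastE _ _ s2).
rewrite -{}ec in s2 *.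
have [small|big] := leqP (size (rcons z a)) (size (h c1)).
  exists [:: c1]; rewrite -(cats1 q1) -(cats1 q2) !suffix_suffix morph1; split => //.
  apply: suffix_le s1 _ small; exact: suffix_suffix.
have /suffixP[z' ez] : suffix (h c1) (rcons z a).
  by apply: suffix_le s1 (ltnW big); rewrite suffix_suffix.
move: s1 s2; rewrite ez !suffix_cat2r => s1 s2.
have [v [v1 v2 vz]] := IH _ _ s1 s2.
exists (rcons v c1); rewrite !suffix_rcons eqxx v1 v2; split => //.
by rewrite morph_rcons suffix_cat2r.
Qed.

(* Equal blocks are followed by equal letters of s, except that the last block is only seen
   up to the branching tl, and the first one is determined by its last letter. *)
Lemma desubstitute_period s w p c : infix w (H s) -> 0 < p -> period p w ->
  cut (drop c (drop p w)) ->
  exists s0 p', [/\ infix s0 s, 0 < p' <= size s0, period p' s0,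
    perm_eq (take p w) (H (take p' s0)) &
    infix (drop p w) (H (drop p' s0) ++ tl)].
Proof.
move=> /infixP[x [y e]] p0 pw cutc.
set v := drop p w in cutc *.
have vw : prefix v w by [].
have cutw : cut (drop c w) by apply: cut_prefix cutc; exact: prefix_drop.
have c_lt : c < size v.
  rewrite ltnNge; apply/negP => le; move: cutc.
  by rewrite (drop_oversize le) (negPf cut0).
(* The two copies of [al], at the start of [w] and [p] letters later, are both followed by a cut.
   Hence [take p z1], a conjugate of the period, lies between block boundaries and is the image of a
   word [u']. *)
set al := take c w.
have sal : size al = c by rewrite size_takel // (leq_trans (ltnW c_lt)) ?size_prefix.
have v_take : take c v = al.
  rewrite /al; move/prefixP: vw => [r er]; rewrite [in RHS]er takel_cat //; exact: ltnW.
set z1 := drop c w; set z2 := drop c v.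
have ew1 : w = al ++ z1 by rewrite cat_take_drop.
have ew2 : w = take p w ++ al ++ z2 by rewrite -v_take !cat_take_drop.
have ep : take p w ++ al = al ++ take p z1.
  have := congr1 (take (p + c)) (etrans (esym ew1) ew2).
  have spw : size (take p w) = p.
    by rewrite size_takel // leqNgt; apply: contraL c_lt => /ltnW lt; rewrite /v drop_oversize.
  rewrite catA [RHS]take_size_cat; last by rewrite size_cat spw sal.
  by rewrite take_cat sal ltnNge leq_addl addnK /= => <-.
have z12 : z1 = take p z1 ++ z2.
  by rewrite -[LHS](cat_take_drop p); congr (_ ++ _); rewrite /z1 /z2 /v !drop_drop addnC.
have [s1 [t1 [es e1 et1]]] : exists s1 s2, [/\ s = s1 ++ s2, x ++ al = H s1 & z1 ++ y = H s2].
  apply: synchronize; first by rewrite e {1}ew1 -!catA.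
  by apply: cut_prefix cutw; exact: prefix_prefix.
have [u' [t2 [et2 eu ez2]]] : exists s1 s2, [/\ t1 = s1 ++ s2, take p z1 = H s1 & z2 ++ y = H s2].
  apply: synchronize; first by rewrite -et1 {1}z12 -catA.
  by apply: cut_prefix cutc; exact: prefix_prefix.
have [||v' [v'1 v'2 v'z]] := @common_prefix z2 t2 t1.
- by rewrite -ez2 prefix_prefix.
- by rewrite -et1; apply: prefix_catl; exact: prefix_drop.
have [||v'' [v''1 v''2 v''z]] := @common_suffix al s1 (s1 ++ u').
- by rewrite -e1 suffix_suffix.
- by rewrite morph_cat -e1 -eu -catA -ep catA suffix_suffix.
(* Moving back over [v''] rotates the period [u'] into its conjugate [m], which has the same letter
   counts. *)
have [m em] : exists m, v'' ++ u' = m ++ v''.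
  have /suffixP[m em] : suffix v'' (v'' ++ u').
    apply: suffix_le v''2 _ _; last by rewrite size_cat leq_addr.
    by rewrite suffix_cat2r.
  by exists m.
have permm : perm_eq m u' by rewrite -(perm_cat2r v'') -em perm_catC.
have v'u : prefix v' (u' ++ v').
  apply: prefix_le v'2 _ _; last by rewrite size_cat leq_addl.
  by rewrite et2 prefix_cat2l.
exists (v'' ++ u' ++ v'), (size m); split.
- rewrite es et2; move/suffixP: v''1 => [a ->]; move/prefixP: v'1 => [b ->].
  by rewrite -!catA; apply/infixP; exists a, b; rewrite -!catA.
- rewrite catA em -catA size_cat leq_addr andbT.
  rewrite lt0n (perm_size permm) size_eq0; apply: contraL p0 => /eqP u0.
  move: eu; rewrite u0 /= => tz; have := congr1 size ep.
  rewrite tz cats0 size_cat size_takel; first lia.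
  by rewrite leqNgt; apply: contraL c_lt => /ltnW lt; rewrite /v drop_oversize.
- rewrite /period catA em -catA drop_size_cat // catA -em -catA.
  by rewrite prefix_cat2l.
- rewrite catA em -catA take_size_cat //.
  have pm : perm_eq (H m) (H u').
    by rewrite /morph; apply: perm_flatten; apply: perm_map.
  rewrite perm_sym (perm_trans pm) // -eu -(perm_cat2l al) -ep perm_catC //.
- rewrite catA em -catA drop_size_cat // morph_cat -v_take in v''z *.
  rewrite -(cat_take_drop c v) -/z2; move/suffixP: v''z => [a ->].
  move/prefixP: v'z => [b eb].
  by apply/infixP; exists a, b; rewrite -?catA eb -?catA.
Qed.

End Overlap.
End Code.

(** * The two morphisms *)

(* The letters a, b are false, true, and the differences +1, -1 modulo 3 are true, false;
   sig is conjugate to a -> aaabb, b -> aaabbbb. *)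
Definition sig (c : bool) : seq bool :=
  if c then [:: true; true; false; false; false; true; true]
  else [:: true; true; false; false; false].
Definition sig_tail : seq bool := [:: true; true; false; false; false; true; true].

Definition tau (c : bool) : seq bool :=
  if c then [:: true; true; true; false; false; true]
  else [:: true; true; true; false; false].
Definition tau_tail : seq bool :=
  [:: true; true; true; false; false; true; true; true].

Lemma sig0 c : sig c != [::]. Proof. by case: c. Qed.
Lemma tau0 c : tau c != [::]. Proof. by case: c. Qed.
Lemma sig_tailP c : prefix sig_tail (sig c ++ sig_tail). Proof. by case: c. Qed.
Lemma tau_tailP c : prefix tau_tail (tau c ++ tau_tail). Proof. by case: c. Qed.

(** The factor [true], [false] occurs exactly once in each block, at offset 1 for [sig] and 2 for
    [tau], and never across two blocks. *)
Definition cut (k : nat) (z : seq bool) := prefix [:: true; false] (drop k z).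
Definition has_cut k (z : seq bool) := has (fun i => cut k (drop i z)) (iota 0 (size z)).

Lemma cut0 k : ~~ cut k [::]. Proof. by case: k. Qed.

Lemma cut_prefix k z z' : prefix z z' -> cut k z -> cut k z'.
Proof. by move=> /(prefix_drop k) zz' /prefix_trans; apply. Qed.

Lemma sig_noCut c s j : 0 < j < size (sig c) -> ~~ cut 1 (drop j (sig c ++ morph sig s)).
Proof.
case: s => [|d s]; first by case: c; do 7?[case: j => [|j] //].
by case: c; case: d; do 7?[case: j => [|j] //].
Qed.

Lemma tau_noCut c s j : 0 < j < size (tau c) -> ~~ cut 2 (drop j (tau c ++ morph tau s)).
Proof.
case: s => [|d s]; first by case: c; do 7?[case: j => [|j] //].
by case: c; case: d; do 7?[case: j => [|j] //].
Qed.

Lemma prefix_branch (T : eqType) (z x u v : seq T) a b : a != b ->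
  prefix z (x ++ a :: u) -> prefix z (x ++ b :: v) -> prefix z x.
Proof.
move=> ab; elim: x z => [|c x IH] [|d z] //=; last first.
  by move=> /andP[-> h1] /andP[_]; apply: IH.
by move=> /andP[/eqP-> _] /andP[/eqP ba]; rewrite ba eqxx in ab.
Qed.

(** After the common prefix [sig_tail], [sig false] and a further block go on with [false], but
    [sig true] and a further block with [true]. *)
Lemma sig_branch z c1 c2 s1 s2 : c1 != c2 ->
  prefix z (sig c1 ++ morph sig s1) -> prefix z (sig c2 ++ morph sig s2) ->
  prefix z sig_tail.
Proof.
wlog: c1 c2 s1 s2 / c1 = false => [H|->].
  case: c1 => ne h1 h2; last exact: (H _ _ _ _ erefl ne h1 h2).
  by apply: (H _ _ _ _ _ _ h2 h1); case: c2 ne {h2}.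
case: c2 => // _; case: s1 => [|d1 s1]; first by move/prefix_trans => + _; apply.
case: s2 => [|d2 s2]; first by move=> _ /prefix_trans; apply.
move=> h1 h2; apply: (@prefix_branch _ _ _ (behead (drop 2 (sig d1 ++ morph sig s1)))
  (behead (sig d2 ++ morph sig s2)) false true) => //.
  by case: d1 h1.
by case: d2 h2.
Qed.

Lemma tau_branch z c1 c2 s1 s2 : c1 != c2 ->
  prefix z (tau c1 ++ morph tau s1) -> prefix z (tau c2 ++ morph tau s2) ->
  prefix z tau_tail.
Proof.
wlog: c1 c2 s1 s2 / c1 = false => [H|->].
  case: c1 => ne h1 h2; last exact: (H _ _ _ _ erefl ne h1 h2).
  by apply: (H _ _ _ _ _ _ h2 h1); case: c2 ne {h2}.
case: c2 => // _; case: s1 => [|d1 s1]; first by move/prefix_trans => + _; apply.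
case: s2 => [|d2 s2]; first by move=> _ /prefix_trans; apply.
move=> h1 h2; apply: (@prefix_branch _ _ _ (behead (drop 3 (tau d1 ++ morph tau s1)))
  (behead (drop 2 (tau d2 ++ morph tau s2))) false true) => //.
  by case: d1 h1.
by case: d2 h2.
Qed.

Lemma sig_last x1 x2 c1 c2 : last x1 (sig c1) = last x2 (sig c2) -> c1 = c2.
Proof. by case: c1; case: c2. Qed.
Lemma tau_last x1 x2 c1 c2 : last x1 (tau c1) = last x2 (tau c2) -> c1 = c2.
Proof. by case: c1; case: c2. Qed.

(** * Letter counts and the factors of the fixed point of [sig] *)

Definition na (w : seq bool) := count negb w.
Definition nb (w : seq bool) := count id w.

Lemma size_nab (w : seq bool) : size w = na w + nb w.
Proof. by rewrite addnC -(count_predC id). Qed.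
Lemma na_cat u v : na (u ++ v) = na u + na v. Proof. exact: count_cat. Qed.
Lemma nb_cat u v : nb (u ++ v) = nb u + nb v. Proof. exact: count_cat. Qed.
Lemma na_infix u v : infix u v -> na u <= na v.
Proof. by move=> /infixP[x [y ->]]; rewrite !na_cat; lia. Qed.
Lemma nb_infix u v : infix u v -> nb u <= nb v.
Proof. by move=> /infixP[x [y ->]]; rewrite !nb_cat; lia. Qed.

Lemma na_sig (w : seq bool) : na (morph sig w) = 3 * na w + 3 * nb w.
Proof. by elim: w => // c w IH; rewrite morph_cons na_cat IH; case: c; rewrite /na /nb /=; lia. Qed.
Lemma nb_sig (w : seq bool) : nb (morph sig w) = 2 * na w + 4 * nb w.
Proof. by elim: w => // c w IH; rewrite morph_cons nb_cat IH; case: c; rewrite /na /nb /=; lia. Qed.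
Lemma na_tau (w : seq bool) : na (morph tau w) = 2 * na w + 2 * nb w.
Proof. by elim: w => // c w IH; rewrite morph_cons na_cat IH; case: c; rewrite /na /nb /=; lia. Qed.
Lemma nb_tau (w : seq bool) : nb (morph tau w) = 3 * na w + 4 * nb w.
Proof. by elim: w => // c w IH; rewrite morph_cons nb_cat IH; case: c; rewrite /na /nb /=; lia. Qed.

Lemma morph_comp (T1 T2 T3 : eqType) (h : T2 -> seq T3) (g : T1 -> seq T2) w :
  morph (fun c => morph h (g c)) w = morph h (morph g w).
Proof. by elim: w => // c w IH; rewrite !morph_cons morph_cat IH. Qed.

Definition sig_factor (w : seq bool) := exists n, infix w (iter n (morph sig) [:: true]).

Lemma sig_factor_factorial : factorial sig_factor.
Proof. by move=> u w uw [n wn]; exists n; apply: infix_trans uw wn. Qed.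

Lemma sig_factor_morph w : sig_factor w -> sig_factor (morph sig w).
Proof. by move=> [n wn]; exists n.+1; apply: infix_morph. Qed.

Lemma sig_factor_desubstitute w : sig_factor w -> exists2 s, sig_factor s & infix w (morph sig s).
Proof.
move=> [[|n] wn]; last by exists (iter n (morph sig) [:: true]) => //; exists n; exact: infix_refl.
exists [:: true]; first by exists 0; exact: infix_refl.
exact: infix_trans wn _.
Qed.

(** A factor meeting three blocks contains the middle one, of length at least [N], and a letter on
    either side. *)
Lemma two_blocks (T : eqType) (h : bool -> seq T) N s w :
  (forall c, N <= size (h c)) -> size w < N.+2 -> infix w (morph h s) ->
  exists x y, infix w (h x ++ h y).
Proof.
move=> hN sw; have [->|w0] := eqVneq w [::].
  by move=> _; exists true, true; exact: infix0s.
move=> /(infix_morph_trim w0)[s' _ [wi [|[a [m [b [es sm]]]]]]].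
  case: s' wi => [|a [|//]]; first by rewrite infixs0 (negPf w0).
  by move=> wi _; exists a, a; rewrite morph1 in wi; apply: infix_catr.
case: m es sm => [|c m] es; last first.
  by rewrite morph_cons size_cat => sm; have := hN c; lia.
by move=> _; exists a, b; move: wi; rewrite es morph_cons morph1.
Qed.

Definition windows (T : Type) n (w : seq T) := [seq take n (drop i w) | i <- iota 0 (size w - n).+1].

Lemma mem_windows (T : eqType) (u w : seq T) : infix u w -> u \in windows (size u) w.
Proof.
move=> /infixP[x [y ->]]; apply/mapP; exists (size x); last by rewrite drop_size_cat ?take_size_cat.
by rewrite mem_iota !size_cat; lia.
Qed.

Definition check_windows (T : Type) (h : bool -> seq T) n (P : pred (seq T)) :=
  all (fun x => all (fun y => all P (windows n (h x ++ h y))) [:: false; true])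
    [:: false; true].

Lemma check_windowsP (T : eqType) (h : bool -> seq T) N n P s (w : seq T) :
  check_windows h n P -> (forall c, N <= size (h c)) -> n <= N -> size w = n ->
  infix w (morph h s) -> P w.
Proof.
move=> /allP ch hN nN sw wi.
have [x [y wxy]] : exists x y, infix w (h x ++ h y).
  by apply: (two_blocks hN _ wi); lia.
have /ch/allP chx : x \in [:: false; true] by case: (x).
have /chx/allP : y \in [:: false; true] by case: (y).
by apply; rewrite -sw mem_windows.
Qed.

(** All images under [sig2] and [tausig] have at least 27 letters, so windows of up to 27 letters
    lie in two consecutive ones. *)
Definition sig2 c := morph sig (sig c).
Definition tausig c := morph tau (sig c).

Lemma sig_factor_check n P w : check_windows sig2 n P -> n <= 27 -> size w = n -> sig_factor w -> P w.
Proof.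
move=> ch n27 sw /sig_factor_desubstitute[s /sig_factor_desubstitute[s' _ ss'] ws].
apply: (check_windowsP (N := 27) (s := s') ch) => //; first by case.
by rewrite morph_comp; apply: infix_trans ws _; apply: infix_morph.
Qed.

(* Under tau o sig^n, the lengths of the period u and of the excess v are affine combinations
   of 6^n, 1 and n, since sig has eigenvalues 6 and 1: (2, 3) is a left eigenvector for 6,
   the tail sig_tail has weight 18, and 18/5 is the fixed point of x = (x + 18)/6.  The first
   inequality bounds the exponent of the ternary word (tau has lengths 5 and 6, tau_tail adds
   8 and integration adds 1), the second one bounds the coefficient of 6^n. *)
Definition light ua ub va vb :=
  (22 * (5 * va + 6 * vb + 9) <= 19 * (5 * ua + 6 * ub)) &&
  (110 * (2 * va + 3 * vb) + 396 <= 95 * (2 * ua + 3 * ub)).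

Definition light_at p (w : seq bool) :=
  if period p w then
    if 3 %| na (take p w) + 2 * nb (take p w) then
      light (na (take p w)) (nb (take p w)) (na (drop p w)) (nb (drop p w))
    else true
  else true.

(** The cases that the descent leaves open: a period of at most 15 letters and an excess of at most
    8. *)
Lemma light_check : all (fun n => check_windows sig2 n
   (fun w => all (light_at^~ w) (iota 1 (minn 15 n.-1)))) (iota 0 24).
Proof. by vm_compute. Qed.

Lemma sig_cut_check : check_windows sig2 9 (has_cut 1).
Proof. by vm_compute. Qed.

Lemma sig_period (s w : seq bool) p c : infix w (morph sig s) -> 0 < p ->
  period p w -> cut 1 (drop c (drop p w)) ->
  exists (s0 : seq bool) p', [/\ infix s0 s, 0 < p' <= size s0, period p' s0 &
    [/\ na (take p w) = 3 * na (take p' s0) + 3 * nb (take p' s0),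
     nb (take p w) = 2 * na (take p' s0) + 4 * nb (take p' s0),
     na (drop p w) <= 3 * na (drop p' s0) + 3 * nb (drop p' s0) + 3 &
     nb (drop p w) <= 2 * na (drop p' s0) + 4 * nb (drop p' s0) + 4]].
Proof.
move=> ws p0 pw cp.
have [s0 [p' [i1 i2 i3 /seq.permP i4 i5]]] := desubstitute_period sig0 (@cut0 1)
  (@cut_prefix 1) sig_noCut sig_branch sig_last ws p0 pw cp.
exists s0, p'; split => //; split.
- by rewrite -na_sig; apply: i4.
- by rewrite -nb_sig; apply: i4.
- by have := na_infix i5; rewrite na_cat na_sig.
- by have := nb_infix i5; rewrite nb_cat nb_sig.
Qed.

Lemma tau_period (s w : seq bool) p c : infix w (morph tau s) -> 0 < p ->
  period p w -> cut 2 (drop c (drop p w)) ->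
  exists (s0 : seq bool) p', [/\ infix s0 s, 0 < p' <= size s0, period p' s0 &
    [/\ na (take p w) = 2 * na (take p' s0) + 2 * nb (take p' s0),
     nb (take p w) = 3 * na (take p' s0) + 4 * nb (take p' s0),
     na (drop p w) <= 2 * na (drop p' s0) + 2 * nb (drop p' s0) + 2 &
     nb (drop p w) <= 3 * na (drop p' s0) + 4 * nb (drop p' s0) + 6]].
Proof.
move=> ws p0 pw cp.
have [s0 [p' [i1 i2 i3 /seq.permP i4 i5]]] := desubstitute_period tau0 (@cut0 2)
  (@cut_prefix 2) tau_noCut tau_branch tau_last ws p0 pw cp.
exists s0, p'; split => //; split.
- by rewrite -na_tau; apply: i4.
- by rewrite -nb_tau; apply: i4.
- by have := na_infix i5; rewrite na_cat na_tau.
- by have := nb_infix i5; rewrite nb_cat nb_tau.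
Qed.

(* The sum modulo 3 of the differences coded by u is na u + 2 * nb u. *)
Lemma sig_factor_light (w : seq bool) p : sig_factor w -> 0 < p <= size w -> period p w ->
  3 %| na (take p w) + 2 * nb (take p w) ->
  light (na (take p w)) (nb (take p w)) (na (drop p w)) (nb (drop p w)).
Proof.
have [n] := ubnP p; elim: n p w => // n IH p w; rewrite ltnS => pn Ww /andP[p0 pw] per ph.
have su : na (take p w) + nb (take p w) = p by rewrite -size_nab size_takel.
have sv : na (drop p w) + nb (drop p w) = size w - p by rewrite -size_nab size_drop.
have [/hasP[c _ cc]|nocut] := boolP (has_cut 1 (drop p w)).
  have [s Ws ws] := sig_factor_desubstitute Ww.
  have [s0 [p' [i1 /andP[p'0 p's] i3 [e1 e2 e3 e4]]]] := sig_period ws p0 per cc.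
  have su' : na (take p' s0) + nb (take p' s0) = p' by rewrite -size_nab size_takel.
  have := IH p' s0 _ (sig_factor_factorial i1 Ws) _ i3.
  rewrite p'0 p's => h; have {h} : light (na (take p' s0)) (nb (take p' s0))
    (na (drop p' s0)) (nb (drop p' s0)) by apply: h => //; lia.
  (* For the image, the second inequality is six times the old one. The first adds [22 (22 va + 33
     vb + 39) <= 19 (22 ua + 33 ub)], which follows from 11/5 of the second since 22·39 is less than
     396·11/5. *)
  by rewrite /light; lia.
have sv8 : size w - p <= 8.
  rewrite -size_drop leqNgt; apply: contra nocut => lt.
  have := @sig_factor_check 9 _ (take 9 (drop p w)) sig_cut_check isT.
  rewrite size_takel // => /(_ erefl) h.
  have /h : sig_factor (take 9 (drop p w)).
    apply: sig_factor_factorial Ww; apply: infix_trans (infix_drop _ p); exact: infix_take.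
  move=> /hasP[c]; rewrite mem_iota size_takel // => /andP[_ c9] cc.
  apply/hasP; exists c; first by rewrite mem_iota; apply: leq_trans c9 lt.
  apply: cut_prefix cc; exact: prefix_drop (prefix_take _ _).
(* With at most 8 letters of excess the second inequality is automatic from period 16 on: 110·24 +
   396 is at most 95·2·16. *)
have [p16|p16] := leqP 16 p; first by rewrite /light; lia.
have [sv0|sv0] := posnP (size w - p); first by rewrite /light; lia.
have := allP light_check (size w); rewrite mem_iota => /(_ _)/sig_factor_check h.
have := h _ _ _ erefl Ww; move/(_ _ _)/allP => h'.
have := h' _ _ p; rewrite mem_iota /light_at per ph /= => -> //; lia.
Qed.

Definition tau_factor (d : seq bool) := exists2 t, sig_factor t & infix d (morph tau t).

Lemma tau_factor_factorial : factorial tau_factor.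
Proof. by move=> u w uw [t Wt wt]; exists t => //; apply: infix_trans uw wt. Qed.

Lemma tau_factor_check n P d : check_windows tausig n P -> n <= 27 -> size d = n -> tau_factor d -> P d.
Proof.
move=> ch n27 sw [t /sig_factor_desubstitute[s _ ts] dt].
apply: (check_windowsP (N := 27) (s := s) ch) => //; first by case.
by rewrite morph_comp; apply: infix_trans dt _; apply: infix_morph.
Qed.

(** Integration adds one letter, so this bounds the exponent of the ternary word by 41/22. The
    difference -1 counts as 2 modulo 3, which swaps the roles of [na] and [nb] with respect to
    [light_at]. *)
Definition short_at p (w : seq bool) :=
  if period p w then
    if 3 %| nb (take p w) + 2 * na (take p w) then 22 * (size w - p + 1) <= 19 * p
    else true
  else true.

Lemma short_check : all (fun n => check_windows tausig n
   (fun w => all (short_at^~ w) (iota 1 (minn 10 n.-1)))) (iota 0 19).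
Proof. by vm_compute. Qed.

Lemma tau_cut_check : check_windows tausig 9 (has_cut 2).
Proof. by vm_compute. Qed.

Lemma tau_factor_short (d : seq bool) p : tau_factor d -> 0 < p <= size d -> period p d ->
  3 %| nb (take p d) + 2 * na (take p d) -> 22 * (size d - p + 1) <= 19 * p.
Proof.
move=> Dd /andP[p0 pd] per ph.
have su : na (take p d) + nb (take p d) = p by rewrite -size_nab size_takel.
have sv : na (drop p d) + nb (drop p d) = size d - p by rewrite -size_nab size_drop.
have [/hasP[c _ cc]|nocut] := boolP (has_cut 2 (drop p d)).
  have [s Ws ds] := Dd.
  have [s0 [p' [i1 /andP[p'0 p's] i3 [e1 e2 e3 e4]]]] := tau_period ds p0 per cc.
  have := sig_factor_light (sig_factor_factorial i1 Ws) _ i3; rewrite p'0 p's => /(_ isT) h.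
  have : 3 %| na (take p' s0) + 2 * nb (take p' s0) by lia.
  (* The excess has at most [5 va + 6 vb + 8] letters and the period [5 ua + 6 ub], so the first
     half of [light] is the claim. *)
  by move/h; rewrite /light; lia.
have sv8 : size d - p <= 8.
  rewrite -size_drop leqNgt; apply: contra nocut => lt.
  have := @tau_factor_check 9 _ (take 9 (drop p d)) tau_cut_check isT.
  rewrite size_takel // => /(_ erefl) h.
  have /h : tau_factor (take 9 (drop p d)).
    apply: tau_factor_factorial Dd; apply: infix_trans (infix_drop _ p); exact: infix_take.
  move=> /hasP[c]; rewrite mem_iota size_takel // => /andP[_ c9] cc.
  apply/hasP; exists c; first by rewrite mem_iota; apply: leq_trans c9 lt.
  apply: cut_prefix cc; exact: prefix_drop (prefix_take _ _).
(* An excess of at most 8 letters is harmless from period 11 on: 22·9 is at most 19·11. *)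
have [p16|p16] := leqP 11 p; first by lia.
have [sv0|sv0] := posnP (size d - p); first by lia.
have := allP short_check (size d); rewrite mem_iota => /(_ _)/tau_factor_check h.
have := h _ _ _ erefl Dd; move/(_ _ _)/allP => h'.
have := h' _ _ p; rewrite mem_iota /short_at per ph /= => -> //; lia.
Qed.

(** * Ternary words and their differences *)

Definition i0 : 'I_3 := @Ordinal 3 0 isT.
Definition i1 : 'I_3 := @Ordinal 3 1 isT.
Definition i2 : 'I_3 := @Ordinal 3 2 isT.

Lemma I3P (c : 'I_3) : [\/ c = i0, c = i1 | c = i2].
Proof.
by case: c => [[|[|[|//]]] lt]; [apply: Or31 | apply: Or32 | apply: Or33]; apply: val_inj.
Qed.

Definition step (c : 'I_3) (b : bool) : 'I_3 :=
  match val c with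
  | 0 => if b then i1 else i2
  | 1 => if b then i2 else i0
  | _ => if b then i0 else i1
  end.

Definition integ c d := c :: scanl step c d.
Definition dif (w : seq 'I_3) : seq bool :=
  if w is c :: w' then pairmap (fun x y => y == step x true) c w' else [::].

Lemma step_inj c : injective (step c).
Proof. by case: (I3P c) => -> [] []. Qed.

Lemma stepK c : cancel (step c) (fun y => y == step c true).
Proof. by case: (I3P c) => -> []. Qed.

Lemma difK c d : dif (integ c d) = d.
Proof. by rewrite /= scanlK //; exact: stepK. Qed.

(** [dif] sends a repeated letter to [false], which integrates to a different letter; hence the
    hypothesis. *)
Lemma integ_dif c w : (forall x, ~~ infix [:: x; x] (c :: w)) -> integ c (dif (c :: w)) = c :: w.
Proof.
rewrite /integ => nsq; congr (_ :: _).
elim: w c nsq => // y w IH c nsq; rewrite /=.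
have -> : step c (y == step c true) = y.
  have := nsq c; rewrite infix_consl negb_or => /andP[+ _].
  rewrite !prefix_cons eqxx prefix0s andbT /=.
  by case: (I3P c) => ->; case: (I3P y) => ->.
congr (_ :: _); apply: IH => x; have := nsq x; apply: contra => h.
by rewrite infix_consl h orbT.
Qed.

Lemma size_integ c d : size (integ c d) = (size d).+1.
Proof. by rewrite /= size_scanl. Qed.

Lemma shift_val c d : val (foldl step c d) = (c + (nb d + 2 * na d)) %% 3.
Proof.
elim: d c => [|b d IH] c /=; first by rewrite addn0 modn_small.
rewrite IH -[X in _ = (X + _) %% 3]/(val c) /na /nb /=.
have -> : val (step c b) = (val c + (if b then 1 else 2)) %% 3.
  by case: (I3P c) => ->; case: b.
by case: b => /=; lia.
Qed.

Lemma shift_id c d : (foldl step c d == c) = (3 %| nb d + 2 * na d).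
Proof.
rewrite -val_eqE /= shift_val; have := ltn_ord c; move: (nat_of_ord c) => n.
by move: (nb d + _) => m n3; apply/eqP/idP; lia.
Qed.

Lemma integ_cat c d1 d2 :
  integ c (d1 ++ d2) = integ c d1 ++ scanl step (foldl step c d1) d2.
Proof. by rewrite /integ scanl_cat. Qed.

Lemma take_integ n c d : take n.+1 (integ c d) = integ c (take n d).
Proof.
rewrite /integ /=; congr (_ :: _).
by elim: n c d => [|n IH] c [|b d] //=; rewrite IH.
Qed.

Lemma drop_integ n c d : n <= size d ->
  drop n (integ c d) = integ (foldl step c (take n d)) (drop n d).
Proof. by elim: n c d => [|n IH] c [|b d] //= nd; rewrite -[RHS]IH. Qed.

Lemma prefix_integ c d c' d' :
  prefix (integ c d) (integ c' d') = (c == c') && prefix d d'.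
Proof.
rewrite /integ /=; have [<-|//] := eqVneq c c'; rewrite /=.
by elim: d d' c => [|b d IH] [|b' d'] c //=; rewrite (inj_eq (@step_inj c)); case: eqP => //= ->.
Qed.

Lemma infix_integ w c d : w != [::] -> infix w (integ c d) ->
  exists c' d', infix d' d /\ w = integ c' d'.
Proof.
move=> w0 /infixP[x [y e]].
have se := congr1 size e; rewrite size_integ !size_cat in se.
have sw : 0 < size w by rewrite lt0n size_eq0.
have lex : size x <= size d by rewrite -ltnS se -[ltnLHS]addn0 ltn_add2l addn_gt0 sw.
exists (foldl step c (take (size x) d)), (take (size w).-1 (drop (size x) d)); split.
  exact: infix_trans (infix_take _ _) (infix_drop _ _).
by rewrite -take_integ prednK // -drop_integ // e drop_size_cat // take_size_cat.
Qed.

Lemma integ_infix c d d' : infix d' d -> exists c', infix (integ c' d') (integ c d).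
Proof.
move=> /infixP[x [y ->]]; exists (foldl step c x); rewrite catA integ_cat.
apply: infix_catr; have -> : integ (foldl step c x) d' = drop (size x) (integ c (x ++ d')).
  by rewrite drop_integ ?size_cat ?leq_addr // take_size_cat // drop_size_cat.
exact: infix_drop.
Qed.

Lemma scanl_rcons (T1 T2 : Type) (f : T1 -> T2 -> T1) x s y :
  scanl f x (rcons s y) = rcons (scanl f x s) (f (foldl f x s) y).
Proof. by rewrite -cats1 scanl_cat cats1. Qed.

Lemma rev_integ c d : rev (integ c d) = integ (foldl step c d) (rev (map negb d)).
Proof.
elim/last_ind: d => //= d b IH.
rewrite /integ foldl_rcons scanl_rcons map_rcons rev_rcons -rcons_cons rev_rcons /=.
rewrite IH /integ; congr (_ :: _); have -> : step (step (foldl step c d) b) (~~ b) = foldl step c d.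
  by case: (I3P (foldl step c d)) => ->; case: b.
by [].
Qed.

Lemma period_integ p c d : p <= size d -> period p (integ c d) ->
  period p d /\ 3 %| nb (take p d) + 2 * na (take p d).
Proof.
by move=> pd; rewrite /period drop_integ // prefix_integ shift_id => /andP[].
Qed.

Lemma integ_period p c d : p <= size d -> period p d ->
  3 %| nb (take p d) + 2 * na (take p d) -> period p (integ c d).
Proof.
by move=> pd per; rewrite -(shift_id c) /period drop_integ // prefix_integ => ->.
Qed.

Definition ternary_factor (z : seq 'I_3) := z = [::] \/ exists c d, tau_factor d /\ z = integ c d.

Lemma ternary_factor_factorial : factorial ternary_factor.
Proof.
move=> u w uw [w0|[c [d [Dd e]]]]; first by left; apply/eqP; rewrite w0 infixs0 in uw.
have [->|u0] := eqVneq u [::]; first by left.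
rewrite e in uw; have [c' [d' [dd' ->]]] := infix_integ u0 uw.
by right; exists c', d'; split => //; apply: tau_factor_factorial dd' Dd.
Qed.

(* In the free group over a, b, the letters 0, 1, 2, 3 stand for bbb, b^-1 aaa b, aaa and
   b aaa bb: then eta acts as sig, and gamma as tau. *)
Inductive decodes : seq 'I_4 -> seq bool -> Prop :=
| decodes_nil : decodes [::] [::]
| decodes0 w t : decodes w t -> decodes (rcons w (inZp 0)) (t ++ [:: true; true; true])
| decodes1 w t : decodes w (rcons t true) ->
   decodes (rcons w (inZp 1)) (t ++ [:: false; false; false; true])
| decodes2 w t : decodes w t -> decodes (rcons w (inZp 2)) (t ++ [:: false; false; false])
| decodes3 w t : decodes w t ->
   decodes (rcons w (inZp 3)) (t ++ [:: true; false; false; false; true; true]).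

Lemma cat_foldl_rcons (T : Type) (u v : seq T) : u ++ v = foldl rcons u v.
Proof. by elim: v u => [|x v IH] u; rewrite ?cats0 // -cat_rcons IH. Qed.

(** In every [eta c] the letter 1 comes right after a 0, whose last b cancels the leading b^-1 of
    1. *)
Lemma decodes_eta w t : decodes w t -> decodes (morph eta w) (morph sig t).
Proof.
elim=> [|{}w {}t _ IH|{}w {}t _ IH|{}w {}t _ IH|{}w {}t _ IH]; first exact: decodes_nil.
- have -> : morph eta (rcons w (inZp 0)) = rcons (rcons (rcons (rcons (rcons (rcons
    (morph eta w) (inZp 0)) (inZp 1)) (inZp 0)) (inZp 2)) (inZp 0)) (inZp 3).
    by rewrite morph_rcons cat_foldl_rcons.
  have h1 : decodes (rcons (rcons (morph eta w) (inZp 0)) (inZp 1))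
      ((morph sig t ++ [:: true; true]) ++ [:: false; false; false; true]).
    by apply: decodes1; rewrite rcons_cat; apply: decodes0.
  by have := decodes3 (decodes0 (decodes2 (decodes0 h1))); rewrite morph_cat -!catA.
- have -> : morph eta (rcons w (inZp 1)) = rcons (rcons (rcons (rcons
    (morph eta w) (inZp 2)) (inZp 0)) (inZp 1)) (inZp 3).
    by rewrite morph_rcons cat_foldl_rcons.
  rewrite morph_rcons in IH.
  have h1 : decodes (rcons (rcons (rcons (morph eta w) (inZp 2)) (inZp 0)) (inZp 1))
     ((((morph sig t ++ sig true) ++ [:: false; false; false]) ++ [:: true; true])
       ++ [:: false; false; false; true]).
    by apply: decodes1; rewrite rcons_cat; apply: decodes0; apply: decodes2.
  by have := decodes3 h1; rewrite morph_cat -!catA.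
- have -> : morph eta (rcons w (inZp 2)) = rcons (rcons (rcons (rcons
    (morph eta w) (inZp 0)) (inZp 1)) (inZp 3)) (inZp 2).
    by rewrite morph_rcons cat_foldl_rcons.
  have h1 : decodes (rcons (rcons (morph eta w) (inZp 0)) (inZp 1))
      ((morph sig t ++ [:: true; true]) ++ [:: false; false; false; true]).
    by apply: decodes1; rewrite rcons_cat; apply: decodes0.
  by have := decodes2 (decodes3 h1); rewrite morph_cat -!catA.
- have -> : morph eta (rcons w (inZp 3)) = rcons (rcons (rcons (rcons (rcons (rcons
    (rcons (rcons (rcons (rcons
    (morph eta w) (inZp 0)) (inZp 1)) (inZp 0)) (inZp 2)) (inZp 0)) (inZp 1)) (inZp 3))
    (inZp 2)) (inZp 0)) (inZp 3).
    by rewrite morph_rcons cat_foldl_rcons.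
  have h1 : decodes (rcons (rcons (morph eta w) (inZp 0)) (inZp 1))
      ((morph sig t ++ [:: true; true]) ++ [:: false; false; false; true]).
    by apply: decodes1; rewrite rcons_cat; apply: decodes0.
  have h2 := decodes2 (decodes0 h1); set t2 := (_ ++ _) in h2.
  have h3 : decodes (rcons (rcons (rcons (rcons (rcons (rcons
      (morph eta w) (inZp 0)) (inZp 1)) (inZp 0)) (inZp 2)) (inZp 0)) (inZp 1))
      ((t2 ++ [:: true; true]) ++ [:: false; false; false; true]).
    by apply: decodes1; rewrite rcons_cat; apply: decodes0.
  by have := decodes3 (decodes0 (decodes2 (decodes3 h3))); rewrite morph_cat /t2 -!catA.
Qed.

Lemma last_scanl (T1 T2 : Type) (f : T1 -> T2 -> T1) x s :
  last x (scanl f x s) = foldl f x s.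
Proof. by elim: s x => //= y s IH x; rewrite IH. Qed.

(** As [integ i0 d] ends in [i0], the sum of [d] is 0 modulo 3 and [d'] is integrated from [i0]
    again. The second hypothesis compares values, so that it holds by computation. *)
Lemma integ_extend u v d d' : u ++ [:: i0] = integ i0 d ->
  map val (i0 :: scanl step i0 d') = map val (v ++ [:: i0]) ->
  (u ++ v) ++ [:: i0] = integ i0 (d ++ d').
Proof.
move=> e /(inj_map val_inj) ev; rewrite integ_cat -e -!catA -ev.
suff -> : foldl step i0 d = i0 by [].
by have := congr1 (last i0) e; rewrite last_cat /= last_scanl.
Qed.

Lemma decodes_gamma w t : decodes w t -> morph gamma w ++ [:: i0] = integ i0 (morph tau t).
Proof.
elim=> [//|{}w {}t _ IH|{}w {}t _ IH|{}w {}t _ IH|{}w {}t _ IH]; rewrite morph_rcons.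
- by rewrite morph_cat; apply: integ_extend IH _.
(* [tau false ++ tau false] starts with [tau true], so b^-1 aaa b still stands for a genuine word of
   15 differences. *)
- have -> : morph tau (t ++ [:: false; false; false; true]) = morph tau (rcons t true) ++
      [:: true; true; false; false; true; true; true; false; false;
          true; true; true; false; false; true].
    by rewrite morph_cat morph_rcons -!catA.
  exact: integ_extend IH _.
- by rewrite morph_cat; apply: integ_extend IH _.
- by rewrite morph_cat; apply: integ_extend IH _.
Qed.

(** * The factors of gamma(eta^omega(0)) *)

Lemma mkseqD (T : Type) (x : nat -> T) m n :
  mkseq x (m + n) = mkseq x m ++ mkseq (fun j => x (m + j)) n.
Proof.
by rewrite /mkseq iotaD map_cat add0n -[in iota m n](addn0 m) iotaDl -map_comp.
Qed.

Lemma infix_mkseq (T : eqType) (x : nat -> T) n a w b : mkseq x n = a ++ w ++ b ->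
  w = mkseq (fun j => x (size a + j)) (size w).
Proof.
move=> e; have := congr1 size e; rewrite size_mkseq !size_cat => en.
move: e; rewrite en mkseqD mkseqD => /eqP.
rewrite eqseq_cat ?size_mkseq // => /andP[_].
by rewrite eqseq_cat ?size_mkseq // => /andP[/eqP->].
Qed.

Lemma factorsP (T : eqType) (x : nat -> T) w :
  factors x w <-> exists n, infix w (mkseq x n).
Proof.
split=> [[i e]|[n /infixP[a [b e]]]]; last by exists (size a); apply: infix_mkseq e.
by exists (i + size w); rewrite mkseqD {1}e suffix_infix.
Qed.

Lemma eta0 c : eta c != [::]. Proof. by case: c => [[|[|[|[|//]]]]]. Qed.
Lemma gamma0 c : gamma c != [::]. Proof. by case: c => [[|[|[|[|//]]]]]. Qed.

Definition eta_iter n := iter n (morph eta) [:: ord0 : 'I_4].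

Definition sig_bbb n := iter n (morph sig) [:: true; true; true].

Lemma decodes_iter n : decodes (eta_iter n) (sig_bbb n).
Proof.
elim: n => [|n IH]; last exact: decodes_eta.
by have := decodes0 decodes_nil; congr decodes; congr (_ :: _); apply: val_inj.
Qed.

Lemma gamma_iter n : morph gamma (eta_iter n) ++ [:: i0] = integ i0 (morph tau (sig_bbb n)).
Proof. exact: decodes_gamma (decodes_iter n). Qed.

Definition eta_tail := word4 [:: 1;0;2;0;3].

Lemma eta_0 : eta ord0 = ord0 :: eta_tail.
Proof. by congr (_ :: _); apply: val_inj. Qed.

Lemma sig_bbb_factor n : sig_factor (sig_bbb n).
Proof. by elim: n => [|n IH]; [exists 2 | exact: sig_factor_morph]. Qed.

Lemma ternary_factor_tau t c : sig_factor t -> ternary_factor (integ c (morph tau t)).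
Proof. by move=> Wt; right; exists c, (morph tau t); split => //; exists t => //; exact: infix_refl. Qed.

Lemma size_eta_iter n : n < size (eta_iter n).
Proof. exact: (size_iter_morph eta0 (s := eta_tail) isT eta_0). Qed.

Lemma eta_iter_prefix m n : m <= n -> prefix (eta_iter m) (eta_iter n).
Proof. exact: (iter_morph_prefix eta_0). Qed.

Lemma gamma_eta_size n : mkseq gamma_eta_omega (size (morph gamma (eta_iter n))) = morph gamma (eta_iter n).
Proof.
have e : mkseq eta_omega (size (eta_iter n)) = eta_iter n.
  exact: (morph_omegaE eta0 (s := eta_tail) isT eta_0).
by have := morph_infE (ord0 : 'I_3) eta_omega (size (eta_iter n)) gamma0; rewrite e.
Qed.

Lemma ph_sig_iter n : na (iter n (morph sig) [:: true]) + 2 * nb (iter n (morph sig) [:: true]) = 2 %[mod 3].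
Proof.
elim: n => //= n; rewrite na_sig nb_sig; lia.
Qed.

(** The sum of [d] is invertible modulo 3, so the copies of [u] in the three copies of [d] start at
    the three different letters. *)
Lemma integ_three d u c c' : (nb d + 2 * na d) %% 3 = 2 -> infix u d ->
  infix (integ c u) (integ c' (d ++ d ++ d)).
Proof.
move=> d2 /infixP[x [y ed]].
have block k : (foldl step c' (flatten (nseq k d) ++ x) == c) -> k < 3 ->
   infix (integ c u) (integ c' (d ++ d ++ d)).
  move=> /eqP <- k3.
  have -> : d ++ d ++ d = (flatten (nseq k d) ++ x) ++ u ++ y ++ flatten (nseq (2 - k) d).
    by case: k k3 => [|[|[|//]]] _ /=; rewrite ?cats0 ed -!catA.
  have := drop_integ c' (n := size (flatten (nseq k d) ++ x))
     (d := (flatten (nseq k d) ++ x) ++ u ++ y ++ flatten (nseq (2 - k) d)).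
  rewrite [leqRHS]size_cat leq_addr => /(_ isT); rewrite take_size_cat // drop_size_cat // => e.
  apply: infix_trans (infix_drop _ (size (flatten (nseq k d) ++ x))).
  by rewrite e integ_cat prefix_infix.
have key k : val (foldl step c' (flatten (nseq k d) ++ x)) =
    (c' + k * 2 + (nb x + 2 * na x)) %% 3.
  rewrite shift_val nb_cat na_cat.
  have : (nb (flatten (nseq k d)) + 2 * na (flatten (nseq k d))) %% 3 = (k * 2) %% 3.
    by elim: k => //= k IH; rewrite nb_cat na_cat; lia.
  by lia.
have k0 := key 0; have k1 := key 1; have k2 := key 2.
set r := (nb x + 2 * na x) in k0 k1 k2.
have : [\/ (c' + r) %% 3 = c, (c' + 2 + r) %% 3 = c | (c' + 4 + r) %% 3 = c].
  have := ltn_ord c; move: (nat_of_ord c) (nat_of_ord c') => n n' n3.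
  suff : [|| (n' + r) %% 3 == n, (n' + 2 + r) %% 3 == n | (n' + 4 + r) %% 3 == n].
    by case/or3P => /eqP; [apply: Or31|apply: Or32|apply: Or33].
  lia.
by case=> h; [apply: (block 0)|apply: (block 1)|apply: (block 2)] => //;
  rewrite -val_eqE; apply/eqP; rewrite ?k0 ?k1 ?k2 -[RHS]/(nat_of_ord c) -h;
  congr (_ %% _); lia.
Qed.

Lemma sig_bbbE n : sig_bbb n = iter n (morph sig) [:: true] ++
  iter n (morph sig) [:: true] ++ iter n (morph sig) [:: true].
Proof. by elim: n => // n IH; rewrite /sig_bbb iterS -/(sig_bbb n) IH !morph_cat. Qed.

Lemma tau_factor_phases d : tau_factor d -> exists n, forall c c',
  infix (integ c d) (integ c' (morph tau (sig_bbb n))).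
Proof.
move=> [t [n tn] dt]; exists n => c c'; rewrite sig_bbbE !morph_cat; apply: integ_three.
  by have := ph_sig_iter n; rewrite na_tau nb_tau; lia.
by apply: infix_trans dt _; apply: infix_morph.
Qed.

Lemma factors_gamma_eta z : factors gamma_eta_omega z <-> ternary_factor z.
Proof.
split=> [/factorsP[n zn]|[->|[c [d [/tau_factor_phases[n /(_ c i0) cdE] ->]]]]].
- apply: (ternary_factor_factorial _ (ternary_factor_tau i0 (sig_bbb_factor n))).
  rewrite -gamma_iter; apply: infix_catr; rewrite -gamma_eta_size.
  apply: infix_trans zn _; apply: prefixW; apply: prefix_mkseq.
  apply: leq_trans (size_morph _ gamma0); exact: ltnW (size_eta_iter n).
- by apply/factorsP; exists 0.
rewrite -gamma_iter in cdE.
(* A longer iterate supplies a block after [eta_iter n]. Every block of [gamma] starts with 0, which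
   is the missing last letter [i0]. *)
pose m := size (eta_iter n).
have /prefixP[[|a r] er] : prefix (eta_iter n) (eta_iter m).
- by apply: eta_iter_prefix; apply: ltnW; apply: size_eta_iter.
- by have := size_eta_iter m; rewrite er cats0 ltnn.
apply/factorsP; exists (size (morph gamma (eta_iter m))).
rewrite gamma_eta_size er morph_cat morph_cons; apply: infix_trans cdE _.
apply: prefixW; rewrite prefix_cat2l; apply: prefix_catl.
by case: a {er} => [[|[|[|[|//]]]]].
Qed.

(** * Repetitions and palindromes of the ternary word *)

Section Powers.
Variable T : eqType.
Implicit Types (w : seq T) (r : rat).

Lemma period_nth x0 p w i : period p w -> p + i < size w -> nth x0 w (p + i) = nth x0 w i.
Proof.
move=> /prefixP[u e] lt; rewrite -nth_drop [in RHS]e nth_cat size_drop.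
by rewrite ltn_subRL lt.
Qed.

Lemma is_power_period r w : is_power r w ->
  exists2 p, 0 < p <= size w & period p w /\ (r = (size w)%:R / p%:R)%R.
Proof.
move=> [r1 [a [s [e er]]]]; set p := size (a :: s) in er.
have p0 : (0 < p%:R :> rat)%R by rewrite ltr0n.
have pw : p <= size w.
  by move: r1; rewrite -er ltr_pdivlMr // mul1r ltr_nat => /ltnW.
exists p; first by rewrite pw.
split=> //; rewrite /period prefixE size_drop.
apply/eqP; apply: (@eq_from_nth _ a); first by rewrite size_takel ?leq_subr // size_drop.
move=> i; rewrite size_takel ?leq_subr // => lti.
rewrite nth_take // nth_drop e !nth_mkseq; last 2 first.
- by rewrite -ltn_subRL.
- by apply: leq_trans lti (leq_subr _ _).
by rewrite /periodic /p modnDl.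
Qed.

Lemma period_is_power p w : 0 < p < size w -> period p w ->
  is_power ((size w)%:R / p%:R)%R w.
Proof.
move=> /andP[p0 pw] per; split; first by rewrite ltr_pdivlMr ?ltr0n // mul1r ltr_nat.
have su : size (take p w) = p by rewrite size_takel // ltnW.
case eu : (take p w) => [|a s]; first by move: p0; rewrite -su eu.
exists a, s; rewrite -eu su; split => //.
apply: (@eq_from_nth _ a) => [|i iw]; rewrite ?size_mkseq ?nth_mkseq // /periodic -eu su.
elim/ltn_ind: i iw => i IH iw; have [lt|le] := ltnP i p.
  by rewrite modn_small // nth_take.
by rewrite -{1 2}(subnKC le) modnDl period_nth ?subnKC // IH //; lia.
Qed.

End Powers.

Lemma gamma_eta_power_free : power_free_plus (41 / 22) (factors gamma_eta_omega).
Proof.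
move=> v r /factors_gamma_eta Lv lt_r /is_power_period[p /andP[p0 pv] [per er]].
have lt : 41 * p < 22 * size v.
  move: lt_r; rewrite er ltr_pdivlMr ?ltr0n // => lt; rewrite -(ltr_nat rat) !natrM; lra.
case: Lv => [v0|[c [d [Dd ev]]]]; first by rewrite v0 in lt.
rewrite ev size_integ in lt; rewrite ev in per.
have pd : p <= size d by lia.
have [perd ph] := period_integ pd per.
have := tau_factor_short Dd _ perd ph; rewrite p0 pd => /(_ isT); lia.
Qed.

(** The empty word and all words of the shapes a, aba, abcba with distinct letters: 1 + 3·5
    words. *)
Definition std : seq (seq 'I_3) := [::] ::
  [seq integ c d | c <- [:: i0; i1; i2],
     d <- [:: [::]; [:: true; false]; [:: false; true];
           [:: true; true; false; false]; [:: false; false; true; true]]].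

(** Reversal reverses and negates the differences, so a middle difference would equal its own
    opposite. *)
Lemma even_palindrome_integ c d : integ c d = rev (integ c d) -> ~~ odd (size d).
Proof.
rewrite rev_integ => /(congr1 dif); rewrite !difK => e; apply/negP => od.
have := congr1 (fun u => nth true u (size d)./2) e.
have lt : (size d)./2 < size d by have := odd_double_half (size d); rewrite od; lia.
rewrite nth_rev ?size_map //.
have -> : size d - (size d)./2.+1 = (size d)./2.
  by have := odd_double_half (size d); rewrite od; lia.
by rewrite (nth_map true) //; case: (nth _ _ _).
Qed.

Lemma palindrome_check : check_windows tausig 6 (fun d => d != rev (map negb d)).
Proof. by vm_compute. Qed.

Lemma alternating_check : check_windows tausig 4
  (fun d => d \notin [:: [:: true; false; true; false]; [:: false; true; false; true]]).
Proof. by vm_compute. Qed.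

Lemma ternary_factor_palindromes w : ternary_factor w /\ w = rev w <-> w \in std.
Proof.
split=> [[[->|[c [d [Dd ->]]]] pal]|]; first by rewrite inE.
- have ed := even_palindrome_integ pal.
  have pd : d = rev (map negb d) by move: pal; rewrite rev_integ => /(congr1 dif); rewrite !difK.
  (* A longer palindrome has at its centre one with six differences, which [palindrome_check]
     excludes. *)
  have sd : size d < 6.
    rewrite ltnNge; apply/negP => d6; pose k := (size d - 6)./2.
    have h : size d = k + (6 + k).
      by have := odd_double_half (size d - 6); rewrite -/k oddB // (negPf ed) /=; lia.
    pose u := take 6 (drop k d).
    have eu : d = take k d ++ u ++ drop 6 (drop k d) by rewrite !cat_take_drop.
    have su : size u = 6 by rewrite size_takel // size_drop; lia.
    have Du : tau_factor u by apply: tau_factor_factorial Dd; rewrite eu infix_infix.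
    have := tau_factor_check palindrome_check isT su Du; rewrite -[negb _]/(~~ _) => /negP[].
    move: pd; rewrite {1 2}eu !map_cat !rev_cat -!catA => /eqP.
    have sA : size (take k d) = k by rewrite size_takel; lia.
    have sB : size (drop 6 (drop k d)) = k by rewrite !size_drop; lia.
    rewrite eqseq_cat ?size_rev ?size_map ?sA ?sB //.
    rewrite eqseq_cat ?size_rev ?size_map // => /andP[_ /andP[]].
    by [].
  have cc : c \in [:: i0; i1; i2] by case: (I3P c) => ->.
  suff dd : d \in [:: [::]; [:: true; false]; [:: false; true];
           [:: true; true; false; false]; [:: false; false; true; true]].
    by rewrite inE; apply/orP; right; apply/allpairsP; exists (c, d).
  move: pd sd Dd; clear.
  case: d => [|[] [|[] [|[] [|[] [|[] [|[] d]]]]]] //= _ _ Dd.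
    by have := tau_factor_check alternating_check isT _ Dd; move/(_ erefl).
  by have := tau_factor_check alternating_check isT _ Dd; move/(_ erefl).
move=> ws; split; last by apply/eqP; move: w ws; apply/allP; vm_compute.
move: ws; rewrite inE => /orP[/eqP->|/allpairsP[[c d] /= [_ dd ->]]]; first by left.
right; exists c, d; split => //; exists (morph sig [:: true]); first by exists 1; exact: infix_refl.
by move: d dd; apply/allP; vm_compute.
Qed.

Local Open Scope classical_set_scope.
Local Open Scope card_scope.

Lemma card_seq_II (T : choiceType) (s : seq T) : uniq s -> [set` s] #= `I_(size s).
Proof.
move=> us; have -> : [set` s] = [set` [fset x in s]%fset].
  by apply/seteqP; split => x /=; rewrite in_fset.
by apply/card_eq_fsetP; rewrite card_fseq undup_id.
Qed.

Lemma card_gamma_eta_palindromes : palindromes (factors gamma_eta_omega) #= `I_16.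
Proof.
have -> : palindromes (factors gamma_eta_omega) = [set` std].
  apply/seteqP; split => w /=; first by move=> [/factors_gamma_eta Lw pw]; apply/ternary_factor_palindromes.
  by move/ternary_factor_palindromes => [Lw pw]; split => //; apply/factors_gamma_eta.
exact: (@card_seq_II _ std).
Qed.

(** * Binary languages without heavy repetitions *)

Definition bools := [:: false; true].

Lemma boolsP b : b \in bools. Proof. by case: b. Qed.

Section Parsing.
Variables (h : bool -> seq bool) (tl : seq bool) (F : seq (seq bool)) (nL nR nC : nat).

Definition parse_check :=
  [&& search (avoid_step F) (fun w => if prefix tl w then has (fun c => prefix (h c ++ tl) w) bools else true)
        bools (size tl + nR) tt [::],
      search (avoid_step F) (fun w => if suffix tl w then has (fun c => suffix (h c ++ tl) w) bools else true)
        bools (nL + size tl) tt [::] &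
      search (avoid_step F) (infix tl) bools nC tt [::]].

Hypothesis ok : parse_check.

Lemma parse_right r : size r = nR -> avoids F (tl ++ r) ->
  exists c, prefix (h c ++ tl) (tl ++ r).
Proof.
case/and3P: ok => s _ _ sr Fr; have := search_avoidsP boolsP s _ Fr.
rewrite size_cat sr prefix_prefix => /(_ erefl)/hasP[c _ hc]; by exists c.
Qed.

Lemma parse_left x : size x = nL -> avoids F (x ++ tl) -> exists c, suffix (h c) x.
Proof.
case/and3P: ok => _ s _ sx Fx; have := search_avoidsP boolsP s _ Fx.
rewrite size_cat sx suffix_suffix => /(_ erefl)/hasP[c _ hc]; exists c.
by rewrite suffix_cat2r in hc.
Qed.

Lemma parse_center w : size w = nC -> avoids F w -> infix tl w.
Proof. by case/and3P: ok => _ _ s sw Fw; exact: (search_avoidsP boolsP s sw Fw). Qed.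

End Parsing.

(* The exponent of the repetition is at least 52/27 under tau o sig^n for n = 0 and n = 1, and
   the coefficient of 6^n is large enough to beat the term linear in n, hence the same holds
   for all n. *)
Definition heavy ua ub va vb :=
  [&& 25 * (5 * ua + 6 * ub) <= 27 * (5 * va + 6 * vb + 9),
      25 * (27 * ua + 39 * ub) <= 27 * (27 * va + 39 * vb + 48) &
      50 * (22 * ua + 33 * ub) <= 54 * (22 * va + 33 * vb + 39) + 27].

Definition heavy_at p (t : seq bool) :=
  [&& 0 < p <= size t, period p t, 3 %| na (take p t) + 2 * nb (take p t) &
    heavy (na (take p t)) (nb (take p t)) (na (drop p t)) (nb (drop p t))].

Definition heavy_free (T : seq bool -> Prop) := forall t p, T t -> ~~ heavy_at p t.

Definition sig_forbidden : seq (seq bool) :=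
  [:: nseq 4 false; nseq 5 true; [:: false; true; false]; [:: true; false; true];
      [:: true; false; false; true]; [:: false; true; true; true; false]].

(* Each word comes with its period. *)
Definition heavy_words : seq (nat * seq bool) :=
 [seq (x.1, [seq c == 1 | c <- x.2]) | x <-
 [:: (3, [:: 1;1;1;1;1]); (2, [:: 1;0;1]); (2, [:: 0;1;0]); (4, [:: 1;1;0;0;1;1]);
     (3, [:: 0;0;0;0]); (6, [:: 0;1;1;1;0;0;0;1;1;1]); (4, [:: 1;0;0;1;1;0;0]);
     (6, [:: 0;0;0;1;1;1;0;0;0;1;1]); (4, [:: 0;0;1;1;0;0;1]);
     (6, [:: 1;0;0;0;1;1;1;0;0;0;1]); (6, [:: 1;1;1;0;0;0;1;1;1;0]);
     (6, [:: 1;1;0;0;0;1;1;1;0;0;0])]].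

Lemma heavy_wordsP : all (fun x => heavy_at x.1 x.2) heavy_words.
Proof. by vm_compute. Qed.

(** Every word of length 11 with a word of [sig_forbidden] at offset 3 contains a heavy word. *)
Lemma heavy_search : search (avoid_step (map snd heavy_words))
  (fun w => avoids_prefix sig_forbidden (drop 3 w)) bools 11 tt [::].
Proof. by vm_compute. Qed.

Lemma sig_parse_check : parse_check sig sig_tail sig_forbidden 7 7 15.
Proof. by vm_compute. Qed.

Definition good T := [/\ extendable T, heavy_free T & T [::]].

Lemma heavy_free_avoids T w : extendable T -> heavy_free T -> T w -> avoids sig_forbidden w.
Proof.
move=> Text Tfree; have [Tf _ _] := Text.
move: w; apply: (search_avoids boolsP Text _ heavy_search) => // w Tw.
apply/allP => f /mapP[[p g] /(allP heavy_wordsP) hpg ->] /=; apply/negP => gw.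
by have := Tfree _ p (Tf _ _ gw Tw); rewrite hpg.
Qed.

Definition sig_down T := desubstitute sig sig_tail T.

Lemma sig_down_good T : good T ->
  good (sig_down T) /\ forall w, T w -> exists2 t, sig_down T t & infix w (morph sig t).
Proof.
move=> [Text Tfree T0]; have TF w := @heavy_free_avoids T w Text Tfree.
have right := parse_right sig_parse_check.
have left := parse_left sig_parse_check.
have center := parse_center sig_parse_check.
have Dext := desubstitute_ext sig_tailP Text TF right left.
have cover := desubstitute_cover sig0 Text TF right center.
split=> //; split=> //.
- move=> t p Tt; apply/negP => /and4P[/andP[p0 pt] per ph hv].
  set u := take p t in ph hv; set v := drop p t in hv.
  have u0 : u != [::] by rewrite -size_eq0 size_takel // -lt0n.
  have per' : period (size (morph sig u)) (morph sig t ++ sig_tail).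
    exact: (period_morph sig_tailP per).
  have et : morph sig t ++ sig_tail = morph sig u ++ (morph sig v ++ sig_tail).
    by rewrite catA -morph_cat cat_take_drop.
  have /negP := Tfree _ (size (morph sig u)) Tt; apply.
  apply/and4P; split => //; rewrite et ?take_size_cat // ?drop_size_cat //.
  + rewrite size_cat leq_addr andbT lt0n size_eq0.
    by case: (u) u0 => // -[].
  + by rewrite na_sig nb_sig; lia.
  (* For the image, the first inequality is the old second one, the second is the old second plus
     three times the old third, and the third follows from six times the old third. *)
  + rewrite na_cat nb_cat !na_sig !nb_sig -[na sig_tail]/3 -[nb sig_tail]/4.
    by move: hv; rewrite /heavy; lia.
- have [t Tt _] := cover _ T0; have [Df _ _] := Dext.
  exact: (factorial_prefix (y := t) Df).
Qed.

Lemma size_sig m : 5 * size m <= size (morph sig m).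
Proof. by elim: m => // c m IH; rewrite morph_cons size_cat /= mulnS leq_add //; case: c. Qed.

(** Induction on the length, over all good languages at once: a word of at least three letters lies
    in the image of a strictly shorter word of [sig_down T], and shorter words all occur in
    sig^2(b). *)
Lemma good_sig_factor T w : good T -> T w -> sig_factor w.
Proof.
have [n] := ubnP (size w); elim: n w T => // n IH w T; rewrite ltnS => wn Tg Tw.
have [small|big] := leqP (size w) 2.
  by case: w small {wn Tw} => [|[] [|[] [|//]]] _; exists 2.
have [Tg' cover] := sig_down_good Tg; have [t Tt wt] := cover _ Tw.
have w0 : w != [::] by case: (w) big.
have [s st [ws sz]] := infix_morph_trim w0 wt.
have [[Df _ _] _ _] := Tg'.
apply: sig_factor_factorial ws _; apply: sig_factor_morph; apply: IH Tg' (Df _ _ st Tt).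
case: sz => [s1|[a [m [b [-> sm]]]]]; first by apply: leq_ltn_trans s1 _; apply: leq_trans wn; lia.
rewrite /= size_rcons; move: (leq_trans big wn) (leq_trans sm wn) (size_sig m).
by move: (size m) (size _) => k l; lia.
Qed.

Lemma good_bbb T n : good T -> T (sig_bbb n).
Proof.
elim: n T => [|n IH] T Tg; have [Tg' _] := sig_down_good Tg; have [[Tf _ _] _ _] := Tg.
  (* The second preimage contains the empty word, so [sig_tail] is in the first one, which thus
     contains b; finally bbb occurs in [sig true ++ sig_tail]. *)
  have [[[Tf' _ _] _ _] [[Tf'' _ _] _ T0]] := (Tg', proj1 (sig_down_good Tg')).
  have T1 : sig_down T [:: true] by apply: Tf' T0.
  by apply: Tf T1.
exact: (factorial_prefix Tf (IH _ Tg')).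
Qed.

Definition free num den (L : seq 'I_3 -> Prop) := forall w p,
  L w -> 0 < p -> period p w -> den * size w < num * p.

Definition tau_forbidden : seq (seq bool) :=
  [:: nseq 3 false; nseq 5 true; [:: false; true; false]; [:: true; false; true];
      [:: false; true; true; false]].

Lemma tau_parse_check : parse_check tau tau_tail tau_forbidden 6 6 15.
Proof. by vm_compute. Qed.

Definition differences (L : seq 'I_3 -> Prop) d := exists c, L (integ c d).

Lemma differences_ext L : extendable L -> (forall w x, L w -> ~~ infix [:: x; x] w) ->
  extendable (differences L).
Proof.
move=> [Lf Ll Lr] sqf.
have integP w c : L (c :: w) -> c :: w = integ c (dif (c :: w)).
  by move=> Lw; rewrite integ_dif // => x; apply: sqf.
split.
- move=> u w uw [c Lc]; have [c' h] := integ_infix c uw.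
  by exists c'; apply: Lf h Lc.
- move=> w [c Lc]; have [a La] := Ll _ Lc.
  have := integP _ _ La; rewrite [dif _]/= (scanlK (@stepK)) => e.
  by exists (c == step a true), a; rewrite -e.
- move=> w [c Lc]; have [a La] := Lr _ Lc; rewrite rcons_cons in La.
  have e := integP _ _ La; set d := dif _ in e.
  have /prefixP[z ez] : prefix w d.
    suff : prefix (integ c w) (integ c d) by rewrite prefix_integ eqxx.
    by rewrite -e -rcons_cons prefix_rcons.
  have := congr1 size e; rewrite size_integ /= size_rcons size_scanl ez size_cat => /eqP.
  rewrite eqSS -addn1 eqn_add2l; case: z ez => [//|b [|//]] ez _.
  by exists b, c; rewrite -cats1 -ez -e.
Qed.

Section Ternary.
Variable L : seq 'I_3 -> Prop.
Hypothesis Lext : extendable L.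
Hypothesis L0 : L [::].
Hypothesis Lfree : free 52 27 L.
Hypothesis Ltau : forall d, differences L d -> avoids tau_forbidden d.

Lemma free_square w x : L w -> ~~ infix [:: x; x] w.
Proof.
move=> Lw; apply/negP => xw; have [Lf _ _] := Lext.
by have := Lfree (Lf _ _ xw Lw) (p := 1); rewrite /period /= eqxx => /(_ isT isT).
Qed.

(** By the first inequality of [heavy], a heavy repetition becomes, under [tau], with [tau_tail]
    appended and integrated, a repetition of exponent at least 52/27. *)
Lemma tau_down : good (desubstitute tau tau_tail (differences L)) /\
  forall d, differences L d ->
    exists2 t, desubstitute tau tau_tail (differences L) t & infix d (morph tau t).
Proof.
have Dext := differences_ext Lext (fun w x => @free_square w x).
have right := parse_right tau_parse_check.
have left := parse_left tau_parse_check.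
have center := parse_center tau_parse_check.
have Text := desubstitute_ext tau_tailP Dext Ltau right left.
have cover := desubstitute_cover tau0 Dext Ltau right center.
have [Lf Ll _] := Lext; have [Tf _ _] := Text.
split=> //; split=> //.
- move=> t p [c Lc]; apply/negP => /and4P[/andP[p0 pt] per ph /and3P[hv _ _]].
  set u := take p t in ph hv; set v := drop p t in hv.
  have u0 : u != [::] by rewrite -size_eq0 size_takel // -lt0n.
  have per' : period (size (morph tau u)) (morph tau t ++ tau_tail).
    exact: (period_morph tau_tailP per).
  have et : morph tau t ++ tau_tail = morph tau u ++ (morph tau v ++ tau_tail).
    by rewrite catA -morph_cat cat_take_drop.
  rewrite et in per' Lc.
  have := integ_period c _ per'; rewrite size_cat leq_addr take_size_cat // => /(_ isT).
  rewrite na_tau nb_tau => h.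
  have /(Lfree Lc) : period (size (morph tau u)) (integ c (morph tau u ++ morph tau v ++ tau_tail)).
    by apply: h; lia.
  rewrite size_integ !size_cat !size_nab !na_tau !nb_tau -[na tau_tail]/2 -[nb tau_tail]/6.
  have : 0 < na u + nb u by rewrite -size_nab lt0n size_eq0.
  by move: hv; lia.
- have [c Lc] := Ll _ L0.
  by have [|t Tt _] := cover [::]; [exists c | apply: (Tf _ _ (infix0s t) Tt)].
Qed.

(** One inclusion pulls [z] back to t. For the other, [good_bbb] puts all sig^n(bbb) into the
    preimage, and their integrals contain every factor with every first letter. *)
Lemma ternary_language z : L z <-> ternary_factor z.
Proof.
have [Tg cover] := tau_down; have [Lf _ _] := Lext; split=> [Lz|].
  case: z Lz => [|c w] Lz; [by left | right].
  have e : c :: w = integ c (dif (c :: w)) by rewrite integ_dif // => x; apply: free_square.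
  exists c, (dif (c :: w)); split => //.
  have [|t Tt dt] := cover (dif (c :: w)); first by exists c; rewrite -e.
  by exists t => //; apply: good_sig_factor Tg Tt.
move=> [->//|[c [d [/tau_factor_phases[n cd] ->]]]].
have [c' Lc] := good_bbb n Tg; apply: Lf Lc; rewrite integ_cat.
by apply: infix_catr; apply: cd.
Qed.

End Ternary.

(** * Unavoidable palindromes *)

Definition letters := [:: i0; i1; i2].

Fixpoint agree n (u v : seq 'I_3) :=
  match n, u, v with
  | 0, _, _ => true
  | n'.+1, a :: u', b :: v' => if eqn a b then agree n' u' v' else false
  | _, _, _ => false
  end.

(* x = (p, n) detects a prefix of length p + n and period p. *)
Definition has_power (pows : seq (nat * nat)) (w : seq 'I_3) :=
  has (fun x => agree x.2 w (drop x.1 w)) pows.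

Definition add_word (P : seq (seq 'I_3)) q := if q \in P then P else q :: P.

Definition prefix_palindromes (lens : seq nat) (w : seq 'I_3) :=
  filter (fun q => q == rev q) [seq take k w | k <- lens].

(* The state P is a list of distinct palindromes of the language. *)
Definition count_step pows forb K P (w : seq 'I_3) :=
  if has (fun f => prefix f w) forb then None
  else if has_power pows w then None
  else let P' := foldl add_word P (prefix_palindromes [:: 3; 5; 7; 9; 11; 13; 15; 17] w) in
       if size P' <= K then Some P' else None.

(* Only the periods that the searches below need. *)
Definition pows_25_13 :=
  [:: (1,1); (2,2); (3,3); (4,4); (6,6); (8,8); (11,11); (12,12); (13,12); (36,34)].
Definition pows_52_27 :=
  [:: (1,1); (2,2); (3,3); (4,4); (6,6); (8,8); (11,11); (12,12); (13,13)].

Definition few_palindromes K (L : seq 'I_3 -> Prop) := forall s, uniq s ->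
  (forall w, w \in s -> L w /\ w = rev w) -> size s <= K.

Definition relabel (f : {perm 'I_3}) (L : seq 'I_3 -> Prop) w := L (map f w).

Definition admissible K num den L :=
  [/\ extendable L, L [::], free num den L & few_palindromes K L].

Lemma infix_map (T1 T2 : eqType) (f : T1 -> T2) u w : infix u w -> infix (map f u) (map f w).
Proof. by move=> /infixP[x [y ->]]; rewrite !map_cat infix_infix. Qed.

Lemma period_map (T1 T2 : eqType) (f : T1 -> T2) p w : period p w -> period p (map f w).
Proof. by move=> /prefixP[y e]; rewrite /period -map_drop {2}e map_cat prefix_prefix. Qed.

Lemma map_permK (f : {perm 'I_3}) w : map f (map (f^-1)%g w) = w.
Proof. by rewrite -map_comp -[RHS]map_id; apply: eq_map => x; rewrite /= permKV. Qed.

Lemma relabel_admissible K num den f L : admissible K num den L -> admissible K num den (relabel f L).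
Proof.
move=> [[Lf Ll Lr] L0 Lfree Lpal]; split=> //; first split.
- by move=> u w uw; apply: Lf; apply: infix_map.
- move=> w /Ll[a La]; exists ((f^-1)%g a); by rewrite /relabel /= permKV.
- move=> w /Lr[a La]; exists ((f^-1)%g a); by rewrite /relabel map_rcons permKV.
- by move=> w p Lw p0 /(period_map f) per; have := Lfree _ _ Lw p0 per; rewrite size_map.
- move=> s us sP; have fi := inj_map (@perm_inj _ f).
  rewrite -(size_map (map f)); apply: Lpal; first by rewrite map_inj_uniq.
  by move=> _ /mapP[w /sP[Lw pw] ->]; split => //; rewrite -map_rev -pw.
Qed.

Lemma relabel_to (a b c : 'I_3) : a != b -> b != c -> a != c ->
  exists f : {perm 'I_3}, [/\ f i0 = a, f i1 = b & f i2 = c].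
Proof.
move=> ab bc ac; pose g (x : 'I_3) := if x == i0 then a else if x == i1 then b else c.
have gi : injective g.
  move=> x y; case: (I3P x) => ->; case: (I3P y) => ->; rewrite /g //= => e;
    by move: ab bc ac; rewrite ?e ?eqxx //= -?e ?eqxx.
by exists (perm gi); rewrite !permE.
Qed.

Lemma lettersP x : x \in letters.
Proof. by case: (I3P x) => ->. Qed.

Lemma agreeP n u v : agree n u v -> [/\ take n u = take n v, n <= size u & n <= size v].
Proof.
elim: n u v => [|n IH] u v; first by rewrite !take0.
by case: u v => [|a u] [|b v] //=; case: eqnP => // /val_inj-> /IH[-> ? ?].
Qed.

Definition valid_powers num den (pows : seq (nat * nat)) :=
  all (fun x => [&& 0 < x.1, 0 < x.2 & num * x.1 <= den * (x.1 + x.2)]) pows.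

Lemma has_powerP num den pows L w : factorial L -> free num den L ->
  valid_powers num den pows -> L w -> ~~ has_power pows w.
Proof.
move=> Lf Lfree /allP ok Lw; apply/hasP => -[[p n] /ok/and3P[/= p0 n0 pn] /agreeP[e _]].
rewrite size_drop => n2; have spn : p + n <= size w by move: n0 n2; move: (size w) => s; lia.
have := Lfree (take (p + n) w) p (Lf _ _ (infix_take _ _) Lw) p0.
rewrite size_takel // ltnNge pn => /(_ _)/negP; case=> //.
rewrite /period addnC -take_drop -e -(take_takel w (leq_addr p n)).
exact: prefix_take.
Qed.

Definition known L (P : seq (seq 'I_3)) := uniq P /\ forall q, q \in P -> L q /\ q = rev q.

Lemma prefix_palindromesP L lens w q : factorial L -> L w ->
  q \in prefix_palindromes lens w -> L q /\ q = rev q.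
Proof.
move=> Lf Lw; rewrite mem_filter => /andP[/eqP pq /mapP[k _ eq]]; split=> //.
by apply: Lf Lw; rewrite eq infix_take.
Qed.

Lemma add_words_known L P Q : known L P -> (forall q, q \in Q -> L q /\ q = rev q) ->
  known L (foldl add_word P Q).
Proof.
elim: Q P => //= q Q IH P [uP PL] QL; apply: IH; last first.
  by move=> q' q'Q; apply: QL; rewrite inE q'Q orbT.
rewrite /add_word; case: ifP => [//|qP]; split; first by rewrite /= qP.
by move=> q'; rewrite inE => /orP[/eqP->|/PL//]; apply: QL; rewrite inE eqxx.
Qed.

Section Counting.
Variables (K num den : nat) (pows : seq (nat * nat)).
Hypothesis pows_ok : valid_powers num den pows.

Lemma count_stepP L forb P w : admissible K num den L -> (forall f, f \in forb -> ~ L f) ->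
  known L P -> L w -> exists2 P', count_step pows forb K P w = Some P' & known L P'.
Proof.
move=> [[Lf _ _] _ Lfree Lpal] nforb kP Lw; rewrite /count_step.
case: hasP => [[f fF fw]|_]; first by case: (nforb f fF); apply: Lf Lw; apply: prefixW.
rewrite (negPf (has_powerP Lf Lfree pows_ok Lw)) /=.
have kP' := add_words_known kP (fun q => prefix_palindromesP Lf Lw).
by rewrite Lpal; [exists (foldl add_word P (prefix_palindromes [:: 3; 5; 7; 9; 11; 13; 15; 17] w))|
  case: (kP' [:: 3; 5; 7; 9; 11; 13; 15; 17])..].
Qed.

(** Without [f], [L] would still extend [w] by [n] letters to the left, but the search, whose leaves
    are all [false], leaves no such extension. *)
Lemma search_unavoidable n L P w f : search (count_step pows [:: f] K) (fun=> false) letters n P w ->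
  admissible K num den L -> known L P -> L w -> L f.
Proof.
move=> s Ladm kP Lw; have [[Lf Ll Lr] _ _ _] := Ladm.
have [//|nf] := pselect (L f).
have [x sx Lx] := extend_left n Ll Lw.
suff : false by [].
have stepP := @count_stepP L [:: f] _ _ Ladm.
apply: (searchP (L := L) (inv := known L) lettersP Lf _ s kP sx Lx) => P' w' kP' Lw'.
by apply: stepP => // g; rewrite inE => /eqP->.
Qed.

End Counting.

Definition palindromes_upto1 : seq (seq 'I_3) := [:: [::]; [:: i0]; [:: i1]; [:: i2]].
Definition palindromes_upto3 := palindromes_upto1 ++ [:: [:: i0; i1; i0]; [:: i0; i2; i0]; [:: i1; i0; i1];
   [:: i1; i2; i1]; [:: i2; i0; i2]; [:: i2; i1; i2]].

(** Up to a permutation of the letters, one palindrome of each shape is enough. Each search starts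
    from palindromes obtained by the previous ones, which already use up part of the allowance
    [K]. *)
Definition unavoidable_check pows K n :=
  [&& search (count_step pows [:: [:: i2]] K) (fun=> false) letters 4 [::] [::],
      search (count_step pows [:: [:: i2; i1; i2]] K) (fun=> false) letters n palindromes_upto1 [:: i0] &
      search (count_step pows [:: [:: i0; i2; i1; i2; i0]] K) (fun=> false) letters n palindromes_upto3
        [:: i2; i1; i2]].

Lemma unavoidable_16 : unavoidable_check pows_52_27 16 60.
Proof. by vm_compute. Qed.

Lemma unavoidable_17 : unavoidable_check pows_25_13 17 130.
Proof. by vm_compute. Qed.

Lemma std_unavoidable K num den pows n L : valid_powers num den pows ->
  unavoidable_check pows K n -> admissible K num den L -> forall w, w \in std -> L w.
Proof.
move=> ok /and3P[c1 c3 c5] Ladm.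
have L1 a : L [:: a].
  have [f <-] : exists f : {perm 'I_3}, f i2 = a by exists (tperm i2 a); rewrite tpermL.
  have fLadm := relabel_admissible f Ladm; have [_ fL0 _ _] := fLadm.
  by apply: (search_unavoidable ok c1 fLadm) fL0.
have known1 f : known (relabel f L) palindromes_upto1.
  split=> // q; rewrite !inE => /or4P[] /eqP-> //; split => //; try exact: L1.
  by case: Ladm.
have L3 a b : a != b -> L [:: a; b; a].
  move=> ab; have [c] : exists c : 'I_3, (c != a) && (c != b).
    by case: (I3P a) ab => ->; case: (I3P b) => -> // _;
       [exists i2|exists i1|exists i2|exists i0|exists i1|exists i0].
  case/andP=> ca cb; rewrite eq_sym in ab.
  have [f [_ <- <-]] := relabel_to cb ab ca.
  by apply: (search_unavoidable ok c3 (relabel_admissible f Ladm) (known1 f)); apply: L1.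
have known3 f : known (relabel f L) palindromes_upto3.
  split=> // q; rewrite mem_cat => /orP[|]; first by apply: (known1 f).2.
  by rewrite !inE => /or4P[/eqP->|/eqP->|/eqP->|/or3P[] /eqP->]; split => //;
     apply: L3; rewrite (inj_eq (@perm_inj _ f)).
have L5 a b c : a != b -> b != c -> a != c -> L [:: a; b; c; b; a].
  move=> ab bc ac; have cb : c != b by rewrite eq_sym.
  have [f [<- <- <-]] := relabel_to ac cb ab.
  apply: (search_unavoidable ok c5 (relabel_admissible f Ladm) (known3 f)).
  by apply: L3; rewrite (inj_eq (@perm_inj _ f)).
move=> w; rewrite inE => /orP[/eqP->|]; first by case: Ladm.
move=> /allpairsP[[c d] /= [cl]]; rewrite !inE => /orP[|/or4P[]] /eqP-> ->.
- exact: L1.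
- by rewrite !inE in cl; case/or3P: cl => /eqP->; apply: L3.
- by rewrite !inE in cl; case/or3P: cl => /eqP->; apply: L3.
- by rewrite !inE in cl; case/or3P: cl => /eqP->; apply: L5.
- by rewrite !inE in cl; case/or3P: cl => /eqP->; apply: L5.
Qed.

(** * Orientation *)

Definition neg (d : seq bool) := map negb d.
Definition tau_forbidden_neg := map neg tau_forbidden.

Lemma dif_cons a b w : dif [:: a, b & w] = (b == step a true) :: dif (b :: w).
Proof. by []. Qed.

Lemma dif_suffix x w : suffix (dif w) (dif (x :: w)).
Proof. by case: w => [|y w]; rewrite ?suffix0s // dif_cons suffix_cons. Qed.

Lemma dif_prefix u v : prefix (dif u) (dif (u ++ v)).
Proof.
elim: u => [|x [|y u] IH]; rewrite ?prefix0s // !cat_cons !dif_cons.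
by rewrite prefix_cons eqxx -cat_cons.
Qed.

Lemma dif_infix u w : infix u w -> infix (dif u) (dif w).
Proof.
move=> /infixP[x [y ->]]; elim: x => [|a x IH]; first exact: prefixW (dif_prefix _ _).
by apply: infix_trans IH _; apply: suffixW (dif_suffix _ _).
Qed.

Lemma take_dif n w : dif (take n.+1 w) = take n (dif w).
Proof.
elim: n w => [|n IH] [|a [|b w]] //; exact: (congr1 (cons (b == step a true)) (IH (b :: w))).
Qed.

Definition plus w := avoids tau_forbidden (dif w).
Definition minus w := avoids tau_forbidden_neg (dif w).

Lemma plus_infix u w : infix u w -> plus w -> plus u.
Proof. by move=> /dif_infix; apply: avoids_infix. Qed.
Lemma minus_infix u w : infix u w -> minus w -> minus u.
Proof. by move=> /dif_infix; apply: avoids_infix. Qed.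

(** A forbidden word has at most 10 differences and so fits into 11 letters; the property slides
    along [w] one letter at a time. *)
Lemma avoids_persist (F : seq (seq bool)) L : all (fun f => size f <= 10) F ->
  factorial L ->
  (forall u, L u -> size u = 12 -> avoids F (dif (take 11 u)) -> avoids F (dif (behead u))) ->
  forall w, L w -> 11 <= size w -> avoids F (dif (take 11 w)) -> avoids F (dif w).
Proof.
move=> /allP F10 Lf local; elim=> // x w IH Lw sw Fw.
have [le|lt] := leqP (size (x :: w)) 11; first by rewrite take_oversize in Fw.
have Fw' : avoids F (dif w).
  have Lw' : L w by apply: Lf Lw; rewrite infix_cons.
  apply: IH => //; have := local (take 12 (x :: w)) (Lf _ _ (infix_take _ _) Lw).
  by rewrite size_takel // take_takel // => /(_ erefl Fw).
case: w {IH} sw lt Fw Fw' Lw => [//|y w] sw lt /allP Fw /allP Fw' _.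
apply/allP => f fF; rewrite dif_cons infix_consl negb_or -dif_cons Fw' // andbT.
apply: contra (Fw f fF) => /(prefix_drop 0); rewrite !drop0 => pf; apply: prefixW.
rewrite take_dif; apply: prefix_le pf (prefix_take _ _) _.
by rewrite size_takel ?F10 //= size_pairmap.
Qed.

Definition squares := [:: (1,1); (2,2); (3,3)].

Definition palindrome_step (S : seq (seq 'I_3)) (_ : unit) (w : seq 'I_3) :=
  if has_power squares w then None
  else if all (fun q => q \in S) (prefix_palindromes [:: 3; 5; 7] w) then Some tt else None.

Lemma squares_valid : valid_powers 52 27 squares. Proof. by []. Qed.

Section Typing.
Variables (L : seq 'I_3 -> Prop) (S : seq (seq 'I_3)).
Hypothesis Lf : factorial L.
Hypothesis Lfree : free 52 27 L.
Hypothesis LS : forall q, L q -> q = rev q -> q \in S.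

Lemma palindrome_searchP leaf n w x : search (palindrome_step S) leaf letters n tt w ->
  size x = n -> L (x ++ w) -> leaf (x ++ w).
Proof.
move=> s; apply: (searchP (inv := fun=> True) lettersP Lf _ s) => // st v _ Lv.
rewrite /palindrome_step (negPf (has_powerP Lf Lfree squares_valid Lv)).
have -> : all (fun q => q \in S) (prefix_palindromes [:: 3; 5; 7] v).
  by apply/allP => q /(prefix_palindromesP Lf Lv)[Lq pq]; apply: LS.
by exists tt.
Qed.

End Typing.

(** A window of 11 letters has exactly one of the two types and shares it with the next window. *)
Definition std_leaf w :=
  (plus (take 11 w) != minus (take 11 w)) && (plus (take 11 w) == plus (behead w)) &&
  (minus (take 11 w) == minus (behead w)).

Lemma std_search : search (palindrome_step std) std_leaf letters 12 tt [::].
Proof. by vm_compute. Qed.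

Definition extra : seq 'I_3 := [:: i0; i1; i2; i0; i2; i1; i0].

(** A change from plus to minus remains possible, but not one from minus to plus. *)
Definition extra_leaf w :=
  ~~ (plus (take 11 w) && minus (take 11 w)) && (minus (take 11 w) ==> minus (behead w)).

Lemma extra_search : search (palindrome_step (extra :: std)) extra_leaf letters 12 tt [::].
Proof. by vm_compute. Qed.

Lemma extra_left_search : search (palindrome_step (extra :: std))
  (fun w => plus (take 11 w)) letters 10 tt extra.
Proof. by vm_compute. Qed.

(** Two factors of a bi-infinite word always lie in a common one; recurrence also allows their order
    to be chosen, which is [irreducible]. *)
Definition directed (L : seq 'I_3 -> Prop) :=
  forall u v, L u -> L v -> exists w, [/\ L w, infix u w & infix v w].

Definition irreducible (L : seq 'I_3 -> Prop) :=
  forall u v, L u -> L v -> exists z, L (u ++ z ++ v).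

Lemma irreducible_directed L : irreducible L -> directed L.
Proof.
move=> Lirr u v Lu Lv; have [z Lz] := Lirr _ _ Lu Lv.
by exists (u ++ z ++ v); split; rewrite ?prefix_infix // catA suffix_infix.
Qed.

(** Each long word has one type throughout, and any two words lie in a common one, so the type of a
    single word of length 11 decides for all of [L]. *)
Lemma std_oriented L : extendable L -> L [::] -> free 52 27 L -> directed L ->
  (forall q, L q -> q = rev q -> q \in std) ->
  (forall w, L w -> plus w) \/ (forall w, L w -> minus w).
Proof.
move=> Lext L0 Lfree Ldir LS; have [Lf _ Lr] := Lext.
have leafP u : L u -> size u = 12 -> std_leaf u.
  move=> Lu su; have := palindrome_searchP Lf Lfree LS std_search su.
  by rewrite cats0; apply.
have xorP u : L u -> 11 <= size u -> plus (take 11 u) != minus (take 11 u).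
  move=> Lu su; have Lt : L (take 11 u) by apply: Lf Lu; apply: infix_take.
  have [y sy Ly] := extend_right 1 Lr Lt.
  have := leafP _ Ly; rewrite size_cat sy size_takel // => /(_ erefl).
  by rewrite /std_leaf take_size_cat ?size_takel // => /andP[/andP[]].
have plusP : forall w, L w -> 11 <= size w -> plus (take 11 w) -> plus w.
  apply: avoids_persist => // u Lu su; have /andP[/andP[_ /eqP e] _] := leafP _ Lu su.
  by rewrite -/(plus _) -/(plus _) e.
have minusP : forall w, L w -> 11 <= size w -> minus (take 11 w) -> minus w.
  apply: avoids_persist => // u Lu su; have /andP[_ /eqP e] := leafP _ Lu su.
  by rewrite -/(minus _) -/(minus _) e.
have [u su Lu] := extend_right 11 Lr L0; rewrite cat0s in Lu.
have u11 : take 11 u = u by rewrite take_oversize ?su.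
have xoru := xorP _ Lu; rewrite su u11 in xoru.
have := xoru isT; case pu : (plus u); case mu : (minus u) => // _; [left | right] => w Lw;
  have [v [Lv uv wv]] := Ldir _ _ Lu Lw;
  have sv : 11 <= size v by rewrite -su; apply: size_infix.
- apply: plus_infix wv _; apply: plusP => //; have := xorP _ Lv sv.
  case: (plus _) => //; case mv: (minus _) => // _.
  by have := minus_infix uv (minusP _ Lv sv mv); rewrite mu.
- apply: minus_infix wv _; apply: minusP => //; have := xorP _ Lv sv.
  case: (minus _) => //; case mv: (plus _) => // _.
  by have := plus_infix uv (plusP _ Lv sv mv); rewrite pu.
Qed.

(** * Reversal and the exchange of the two types *)

Definition reversed (L : seq 'I_3 -> Prop) w := L (rev w).

Lemma period_rev (T : eqType) p (w : seq T) : period p w -> period p (rev w).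
Proof.
rewrite /period; have [le|/ltnW le] := leqP p (size w); last first.
  by rewrite (@drop_oversize _ p (rev w)) ?size_rev // prefix0s.
rewrite !prefixE !size_drop size_rev => /eqP e.
by rewrite take_rev drop_rev subKn // e.
Qed.

Lemma reversed_extendable L : extendable L -> extendable (reversed L).
Proof.
move=> [Lf Ll Lr]; split.
- by move=> u w uw; apply: Lf; rewrite infix_rev.
- by move=> w /Lr[a La]; exists a; rewrite /reversed rev_cons.
- by move=> w /Ll[a La]; exists a; rewrite /reversed rev_rcons.
Qed.

Lemma reversed_free num den L : free num den L -> free num den (reversed L).
Proof.
by move=> Lfree w p Lw p0 /period_rev per; have := Lfree _ _ Lw p0 per; rewrite size_rev.
Qed.

Lemma rev_palindromes (S : seq (seq 'I_3)) (L : seq 'I_3 -> Prop) :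
  (forall q, L q -> q = rev q -> q \in S) ->
  forall q, reversed L q -> q = rev q -> q \in S.
Proof. by move=> LS q Lq pq; apply: LS; rewrite // pq. Qed.

Lemma dif_integ_rev c d : dif (rev (integ c d)) = rev (neg d).
Proof. by rewrite rev_integ difK. Qed.

Lemma tau_forbidden_rev f : f \in tau_forbidden -> rev f = f.
Proof. by move=> ft; apply/eqP; move: f ft; apply/allP. Qed.

(** The words of [tau_forbidden] are palindromes, so reversing and negating the differences only
    negates the forbidden words. *)
Lemma avoids_rev_neg d : avoids tau_forbidden_neg (rev (neg d)) = avoids tau_forbidden d.
Proof.
rewrite /avoids /tau_forbidden_neg all_map; apply: eq_in_all => f /tau_forbidden_rev rf /=.
rewrite -{1}rf /neg map_rev infix_rev; congr (~~ _).
have nK : involutive (map negb) by move=> u; rewrite -map_comp -[RHS]map_id; apply: eq_map => -[].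
by apply/idP/idP => /(infix_map negb); rewrite ?nK.
Qed.

Lemma minus_rev c d : minus (rev (integ c d)) = plus (integ c d).
Proof. by rewrite /minus /plus dif_integ_rev avoids_rev_neg difK. Qed.

Section Classification.
Variable L : seq 'I_3 -> Prop.
Hypothesis Lext : extendable L.
Hypothesis L0 : L [::].
Hypothesis Lfree : free 52 27 L.

Lemma oriented_language :
  (forall w, L w -> plus w) \/ (forall w, L w -> minus w) ->
  (forall z, L z <-> ternary_factor z) \/ (forall z, L z <-> ternary_factor (rev z)).
Proof.
case=> LP; [left|right].
  apply: ternary_language => // d [c Lc].
  by have := LP _ Lc; rewrite /plus difK.
move=> z; rewrite -{1}[z]revK; apply: (ternary_language (L := reversed L)).
- exact: reversed_extendable.
- by [].
- exact: reversed_free.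
- move=> d [c Lc]; have := LP _ Lc; rewrite minus_rev.
  by rewrite /plus difK.
Qed.

(* A word of type plus can only be followed by one of type minus through [extra], and
   nothing leads back, so [extra] cannot recur. *)
Lemma extra_transient : irreducible L ->
  (forall q, L q -> q = rev q -> q \in extra :: std) -> ~ L extra.
Proof.
move=> Lirr LS Lp; have [Lf Ll Lr] := Lext.
have leafP u : L u -> size u = 12 -> extra_leaf u.
  move=> Lu su; have := palindrome_searchP Lf Lfree LS extra_search su.
  by rewrite cats0; apply.
have minusP : forall w, L w -> 11 <= size w -> minus (take 11 w) -> minus w.
  apply: avoids_persist => // u Lu su; have /andP[_ /implyP] := leafP _ Lu su; exact.
have [x sx Lx] := extend_left 10 Ll Lp.
have px := palindrome_searchP Lf Lfree LS extra_left_search sx Lx.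
(* [extra] is a palindrome, so [extra_left_search] also applies to the reversed language and yields
   a word of type minus to the right of [extra]. *)
have [Rf Rl _] := reversed_extendable Lext.
have [y sy Ly] := extend_left 10 Rl (Lp : reversed L extra).
have py := palindrome_searchP Rf (reversed_free Lfree) (rev_palindromes LS) extra_left_search sy Ly.
set v := take 11 (y ++ extra) in py.
have Rv : reversed L v by apply: Rf Ly; apply: infix_take.
have sv : size v = 11 by rewrite size_takel // size_cat sy.
have mv : minus (rev v).
  case ev : v Rv sv py => [//|c w] Rv _ py.
  have e : c :: w = integ c (dif (c :: w)).
    rewrite integ_dif // => a.
    exact: (free_square (reversed_extendable Lext) (reversed_free Lfree) a Rv).
  by rewrite e minus_rev -e.
(* Irreducibility places this word of type minus before [x ++ extra]. Type minus then persists up to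
   the first 11 letters of [x ++ extra], which are of type plus. *)
have [z Lz] := Lirr _ _ (Rv : L (rev v)) Lx.
have := minusP _ Lz; rewrite size_cat take_size_cat size_rev sv // leq_addr => /(_ isT mv) m.
have mx : minus (take 11 (x ++ extra)).
  apply: minus_infix m; apply: infix_trans (infix_take _ _) _.
  by rewrite catA suffix_infix.
have := leafP (take 12 (x ++ extra)) (Lf _ _ (infix_take _ _) Lx).
rewrite size_takel ?size_cat ?sx // => /(_ erefl).
by rewrite /extra_leaf take_takel // px mx.
Qed.

End Classification.

(** * The possible seventeenth palindrome *)

Definition contains_power pows (u : seq 'I_3) :=
  has (fun k => has_power pows (drop k u)) (iota 0 (size u)).

Definition extras : seq (seq 'I_3) :=
  [seq [:: x.1.1; x.1.2; x.2; x.1.1; x.2; x.1.2; x.1.1] | x <- [seq x <-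
    [seq (y, c) | y <- [seq (a, b) | a <- letters, b <- letters], c <- letters] |
    [&& x.1.1 != x.1.2, x.1.2 != x.2 & x.1.1 != x.2]]].

(** The last alternative needs one more letter on the left before a repetition appears. *)
Definition extension_ok (w : seq 'I_3) := [|| w \in std, w \in extras |
  all (fun a => contains_power ((4, 4) :: squares) (a :: w)) letters].

Lemma palindrome_extension_check :
  all (fun x => all (fun q => extension_ok (x :: rcons q x)) std) letters.
Proof. by vm_compute. Qed.

Lemma std_uniq : uniq std. Proof. by vm_compute. Qed.
Lemma std_palindrome q : q \in std -> q = rev q.
Proof. by move=> qs; apply/eqP; move: q qs; apply/allP; vm_compute. Qed.

Lemma powers4_valid : valid_powers 52 27 ((4, 4) :: squares). Proof. by []. Qed.

Section FewPalindromes.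
Variable L : seq 'I_3 -> Prop.
Hypothesis stdL : forall w, w \in std -> L w.

Lemma few_palindromes_16 : few_palindromes 16 L ->
  forall q, L q -> q = rev q -> q \in std.
Proof.
move=> few q Lq pq; apply/negPn/negP => nq; have := few (q :: std).
rewrite cons_uniq nq std_uniq => /(_ isT) h; suff : 17 <= 16 by [].
by apply: h => w; rewrite inE => /orP[/eqP->|ws] //; split; [exact: stdL|exact: std_palindrome].
Qed.

Lemma few_palindromes_17 q : few_palindromes 17 L -> L q -> q = rev q -> q \notin std ->
  forall q', L q' -> q' = rev q' -> q' \in q :: std.
Proof.
move=> few Lq pq nq q' Lq' pq'; apply/negPn/negP => nq'; have := few (q' :: q :: std).
rewrite cons_uniq nq' cons_uniq nq std_uniq => /(_ isT) h; suff : 18 <= 17 by [].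
apply: h => w; rewrite inE => /orP[/eqP->//|]; rewrite inE => /orP[/eqP->//|ws].
by split; [exact: stdL | exact: std_palindrome].
Qed.

Hypothesis Lext : extendable L.
Hypothesis Lfree : free 52 27 L.

(** Without its two end letters, [q] is a shorter palindrome of [L], hence in [std]; this leaves the
    finitely many words of [palindrome_extension_check]. *)
Lemma extra_palindrome q : few_palindromes 17 L -> L q -> q = rev q -> q \notin std ->
  q \in extras.
Proof.
move=> few Lq pq nq; have inS := few_palindromes_17 few Lq pq nq.
case: q Lq pq nq inS => [|x q'] Lq pq nq inS; first by [].
case/lastP: q' Lq pq nq inS => [|q1 y] Lq pq nq inS.
  by move: nq; case: (I3P x) => ->.
have [Lf Ll _] := Lext.
have [xy pq1] : x = y /\ q1 = rev q1.
  move: pq; rewrite rev_cons rev_rcons rcons_cons => -[-> /eqP].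
  by rewrite eqseq_rcons => /andP[/eqP].
have q1s : q1 \in std.
  have Lq1 : L q1 by apply: Lf Lq; rewrite -cats1; apply: (infix_infix [:: x] _ [:: y]).
  have := inS _ Lq1 pq1; rewrite inE => /orP[/eqP e|//].
  by have := congr1 size e; rewrite /= size_rcons; lia.
have chk : all (fun q => extension_ok (x :: rcons q x)) std.
  exact: (allP palindrome_extension_check x (lettersP x)).
have {chk} : extension_ok (x :: rcons q1 x) by exact: (allP chk q1 q1s).
rewrite -xy in Lq nq *; rewrite /extension_ok (negPf nq) orFb => /orP[//|/allP h].
have [a La] := Ll _ Lq.
have /hasP[k _] : contains_power ((4, 4) :: squares) (a :: x :: rcons q1 x).
  exact: (h a (lettersP a)).
apply: contraTT => _; apply: (has_powerP Lf Lfree powers4_valid).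
by apply: Lf La; exact: infix_drop.
Qed.

End FewPalindromes.

Lemma relabel_irreducible f L : irreducible L -> irreducible (relabel f L).
Proof.
move=> Lirr u v Lu Lv; have [z Lz] := Lirr _ _ Lu Lv.
by exists (map (f^-1)%g z); rewrite /relabel !map_cat map_permK.
Qed.

Lemma pows_52_27_valid : valid_powers 52 27 pows_52_27. Proof. by []. Qed.
Lemma pows_25_13_valid : valid_powers 25 13 pows_25_13. Proof. by []. Qed.

Lemma free_25_13 L : free 25 13 L -> free 52 27 L.
Proof. by move=> Lfree w p Lw p0 per; have := Lfree _ _ Lw p0 per; lia. Qed.

Lemma classification_16 L : admissible 16 52 27 L -> directed L ->
  (forall z, L z <-> ternary_factor z) \/ (forall z, L z <-> ternary_factor (rev z)).
Proof.
move=> Ladm Ldir; have stdL := std_unavoidable pows_52_27_valid unavoidable_16 Ladm.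
have [Lext L0 Lfree few] := Ladm.
apply: oriented_language => //; apply: std_oriented => //.
exact: few_palindromes_16.
Qed.

Lemma classification_17 L : admissible 17 25 13 L -> irreducible L ->
  (forall z, L z <-> ternary_factor z) \/ (forall z, L z <-> ternary_factor (rev z)).
Proof.
move=> Ladm Lirr; have stdL := std_unavoidable pows_25_13_valid unavoidable_17 Ladm.
have [Lext L0 /free_25_13 Lfree few] := Ladm.
apply: oriented_language => //; apply: std_oriented => //.
  exact: irreducible_directed.
move=> q Lq pq; apply/negPn/negP => nq.
have /mapP[[[a b] c]] := extra_palindrome stdL Lext Lfree few Lq pq nq.
rewrite mem_filter => /= /andP[/and3P[ab bc ac] _] eq.
(* Relabelling turns the seventeenth palindrome into [extra], which [extra_transient] excludes. *)
have [f [fa fb fc]] := relabel_to ab bc ac.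
have fLadm := relabel_admissible f Ladm; have [fext f0 /free_25_13 ffree ffew] := fLadm.
have fstd := std_unavoidable pows_25_13_valid unavoidable_17 fLadm.
have fextra : relabel f L extra by rewrite /relabel /= fa fb fc -eq.
apply: (extra_transient fext ffree (relabel_irreducible Lirr) _ fextra).
by apply: few_palindromes_17.
Qed.

Local Open Scope classical_set_scope.
Local Open Scope card_scope.

(** * Factor languages *)

Lemma power_free_free num den (L : set (seq 'I_3)) : den < num -> 0 < den ->
  power_free (num%:R / den%:R) L -> free num den L.
Proof.
move=> lt den0 Lfree w p Lw p0 per; rewrite ltnNge; apply/negP => le.
have pw : 0 < p < size w by rewrite p0; move: (size w) le => s le; nia.
apply: (Lfree w ((size w)%:R / p%:R)%R) => //; last exact: period_is_power.
rewrite ler_pdivlMr ?ltr0n // mulrAC ler_pdivrMr ?ltr0n // -!natrM ler_nat.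
by rewrite [leqRHS]mulnC.
Qed.

Lemma palindromes_few K (L : set (seq 'I_3)) : palindromes L #<= `I_K -> few_palindromes K L.
Proof.
move=> LK s us sP; rewrite -card_le_II.
have : [set` s] #<= palindromes L by apply: subset_card_le => w /= /sP[].
move=> /card_le_trans/(_ LK); by rewrite (card_le_eql (card_seq_II us)).
Qed.

Lemma factors_or_rev (L : set (seq 'I_3)) :
  (forall z, L z <-> ternary_factor z) \/ (forall z, L z <-> ternary_factor (rev z)) ->
  L = factors gamma_eta_omega \/ L = rev @` factors gamma_eta_omega.
Proof.
case=> LP; [left|right]; apply/seteqP; split => z.
- by move=> /LP/factors_gamma_eta.
- by move=> /factors_gamma_eta/LP.
- by move=> /LP/factors_gamma_eta Fz; exists (rev z); rewrite ?revK.
- by move=> [u /factors_gamma_eta Lu <-]; apply/LP; rewrite revK.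
Qed.

Section Bifactors.
Variables (T : eqType) (y : int -> T).
Local Notation window i := (fun j : nat => y (i + j%:Z)%R).

Lemma bifactorsP w : bifactors y w <-> exists i n, infix w (mkseq (window i) n).
Proof.
split=> [[i e]|[i [n /infixP[a [b e]]]]]; first by exists i, (size w); rewrite -e infix_refl.
exists (i + (size a)%:Z)%R; rewrite {1}(infix_mkseq e).
by apply: eq_mkseq => j /=; rewrite PoszD addrA.
Qed.

Lemma infix_window i k m n : (k <= i)%R -> (i + m%:Z <= k + n%:Z)%R ->
  infix (mkseq (window i) m) (mkseq (window k) n).
Proof.
move=> ki le; have [t it] : exists t : nat, i = (k + t%:Z)%R.
  by exists `|i - k|%N; lia.
have -> : n = t + (m + (n - (t + m))) by lia.
rewrite !mkseqD; apply: infix_catl; apply: infix_catr.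
suff -> : mkseq (window i) m = mkseq (fun j => window k (t + j)) m by apply: infix_refl.
by apply: eq_mkseq => j; rewrite it PoszD addrA.
Qed.

Lemma bifactors_extendable : extendable (bifactors y).
Proof.
split.
- by move=> u w uw /bifactorsP[i [n wn]]; apply/bifactorsP; exists i, n; apply: infix_trans wn.
- move=> w [i e]; exists (y (i - 1)%R), (i - 1)%R.
  rewrite [size _]/= -add1n mkseqD -cat1s; congr (_ ++ _).
    by rewrite /mkseq /= addr0.
  by rewrite {1}e; apply: eq_mkseq => j; rewrite PoszD addrA subrK.
- move=> w [i e]; exists (window i (size w)), i.
  by rewrite size_rcons -addn1 mkseqD -e cats1 /mkseq /= addn0.
Qed.

Lemma bifactors_directed u v : bifactors y u -> bifactors y v ->
  exists w, [/\ bifactors y w, infix u w & infix v w].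
Proof.
move=> [i eu] [k ev]; pose m := Order.min i k; pose n := (size u + size v + `|i - k|)%N.
exists (mkseq (window m) n); split.
- by apply/bifactorsP; exists m, n; apply: infix_refl.
- by rewrite eu; apply: infix_window; rewrite /m /n; lia.
- by rewrite ev; apply: infix_window; rewrite /m /n; lia.
Qed.

End Bifactors.

Section RecurrentFactors.
Variables (T : eqType) (x : nat -> T).
Hypothesis xrec : recurrent x.

Lemma recurrent_occurs w n : factors x w -> exists2 i, n <= i & occurs_at x w i.
Proof.
move=> /xrec inf; apply: contrapT => nex; apply: inf.
apply: (sub_finite_set (B := `I_n)) => // i /= wi.
by rewrite ltnNge; apply/negP => ni; apply: nex; exists i.
Qed.

Lemma recurrent_extendable : extendable (factors x).
Proof.
split.
- by move=> u w uw /factorsP[n wn]; apply/factorsP; exists n; apply: infix_trans wn.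
(* An occurrence at a positive position has a letter before it. *)
- move=> w Fw; have [[//|i] _ e] := recurrent_occurs 1 Fw.
  exists (x i), i; rewrite /occurs_at [size _]/= -add1n mkseqD -cat1s; congr (_ ++ _).
    by rewrite /mkseq /= addn0.
  by rewrite {1}e; apply: eq_mkseq => j; rewrite add1n addnS addSn.
- move=> w [i e]; exists (x (i + size w)), i.
  by rewrite /occurs_at size_rcons -addn1 mkseqD -e cats1 /mkseq /= addn0.
Qed.

Lemma recurrent_irreducible u v : factors x u -> factors x v ->
  exists z, factors x (u ++ z ++ v).
Proof.
(* An occurrence of [v] is taken beyond the end of [u], and [z] is the gap between them. *)
move=> [i eu] Fv; have [k ik ev] := recurrent_occurs (i + size u) Fv.
exists (mkseq (fun j => x (i + size u + j)) (k - (i + size u))), i.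
rewrite /occurs_at !size_cat size_mkseq !mkseqD {1}eu; congr (_ ++ _).
have e2 : mkseq (fun j => x (i + size u + j)) (k - (i + size u)) =
  mkseq (fun j => x (i + (size u + j))) (k - (i + size u)).
  by apply: eq_mkseq => j; rewrite addnA.
rewrite e2; congr (_ ++ _); rewrite {1}ev; apply: eq_mkseq => j.
by rewrite !addnA -(addnA i) addnA subnKC.
Qed.

End RecurrentFactors.

Local Open Scope ring_scope.

Theorem theorem8 :
  (palindromes (factors gamma_eta_omega) #= `I_16 /\
   power_free_plus (41 / 22) (factors gamma_eta_omega)) /\
  (forall y : int -> 'I_3,
     power_free (52 / 27) (bifactors y) ->
     palindromes (bifactors y) #<= `I_16 ->
     bifactors y = factors gamma_eta_omega \/
     bifactors y = rev @` factors gamma_eta_omega) /\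
  (forall x : nat -> 'I_3,
     recurrent x ->
     power_free (25 / 13) (factors x) ->
     palindromes (factors x) #<= `I_17 ->
     factors x = factors gamma_eta_omega \/
     factors x = rev @` factors gamma_eta_omega).
Proof.
split; first by split; [exact: card_gamma_eta_palindromes | exact: gamma_eta_power_free].
split=> [y yfree ypal|x xrec xfree xpal]; apply: factors_or_rev.
- apply: classification_16; last exact: bifactors_directed.
  split; [exact: bifactors_extendable| by exists 0| | exact: palindromes_few].
  exact: power_free_free.
- apply: classification_17; last exact: recurrent_irreducible.
  split; [exact: recurrent_extendable| by exists 0%N| | exact: palindromes_few].
  exact: power_free_free.
Qed.
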